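(* Let $\varphi:\mathfrak g\to\mathfrak X(M)$ be a symplectic action of a Lie algebra $\mathfrak g$ on a symplectic manifold $(M,\omega_M)$. Then the lifted action on $(TM,d_T\omega_M)$ is Hamiltonian, with fiberwise-linear momentum map $c:TM\to\mathfrak g^*$ defined by $$c_\xi=i_T(i_{\varphi(\xi)}\omega_M),\qquad \xi\in\mathfrak g,$$ where $c_\xi(v)=\langle c(v),\xi\rangle$.
   Context: A symplectic action of $\mathfrak g$ is a Lie algebra homomorphism $\varphi:\mathfrak g\to\mathfrak X(M)$ (vector fields on $M$) with $\mathcal L_{\varphi(\xi)}\omega_M=0$ for all $\xi$. The lifted action on $TM$ assigns to $\xi$ the complete (tangent) lift of $\varphi(\xi)$, i.e. the vector field $\varphi^T(\xi)=k_M\circ T(\varphi(\xi))$ on $TM$, with $k_M:TTM\to TTM$ the canonical involution; its flow is the tangent map of the flow of $\varphi(\xi)$. With $\tau_M:TM\to M$ the projection, $i_T:\Omega^k(M)\to\Omega^{k-1}(TM)$ is defined by $(i_T\omega)_v(w_1,\dots,w_{k-1})=\omega_{\tau_M(v)}(v,T\tau_M(w_1),\dots,T\tau_M(w_{k-1}))$ for $v\in TM$, $w_j\in T_v(TM)$, with $i_T=0$ on functions; for a $1$-form $\theta$, $i_T\theta(v)=\langle\theta(\tau_M(v)),v\rangle$. Further $d_T\omega=i_Td\omega+d\,i_T\omega$ (the complete lift of $\omega$); $d_T\omega_M$ is a symplectic form on $TM$. On a symplectic manifold $(P,\Omega)$ the Hamiltonian vector field $X_f$ is defined by $i_{X_f}\Omega=df$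 and $\{f,g\}=X_f(g)$. An infinitesimal action $\psi$ of $\mathfrak g$ on $P$ is Hamiltonian with momentum map $J:P\to\mathfrak g^*$ if $\psi(\xi)=X_{J_\xi}$, $J_\xi=\langle J,\xi\rangle$, for all $\xi$, and $J$ is a Poisson map for the Lie–Poisson structure on $\mathfrak g^*$, i.e. $\{J_\xi,J_\eta\}=J_{[\xi,\eta]}$. *)

(* Defs.v *)
From HB Require Import structures.
From mathcomp Require Import all_boot all_order all_algebra.
From mathcomp Require Import all_classical all_reals all_analysis.

Set Implicit Arguments.
Unset Strict Implicit.
Unset Printing Implicit Defensive.

Import Order.TTheory GRing.Theory Num.Theory.
Import numFieldNormedType.Exports.

Local Open Scope classical_set_scope.
Local Open Scope ring_scope.

(** Model spaces are written [E], [F] : normedModType R only so that the tangent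
    bundle of a manifold modelled on [E] can be modelled on [E * E].  They are
    meant to be finite dimensional, where C^k in the sense of [Ck] (iterated
    directional derivatives are Frechet differentiable) is the usual notion. *)

Fixpoint Ck (R : realType) (E F : normedModType R) (k : nat) (U : set E)
    (f : E -> F) : Prop :=
  match k with
  | 0 => forall x, U x -> {for x, continuous f}
  | k'.+1 => (forall x, U x -> differentiable f x) /\
             (forall v : E, Ck k' U (fun x => 'D_v f x))
  end.

Definition smooth_on (R : realType) (E F : normedModType R) (U : set E)
    (f : E -> F) : Prop := forall k, Ck k U f.

(** A set with a family of charts.  Chart [i] is the map [cmap i], of interest
    on [cdom i] only, and [cinv i] is its inverse, of interest on
    [cmap i @` cdom i] only.  Every point [p] has a preferred chart
    [chart_at p], used to represent tangent vectors at [p]. *)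
Record mfd (R : realType) (E : normedModType R) := Mfd {
  carrier :> Type;
  chart : Type;
  cdom : chart -> set carrier;
  cmap : chart -> carrier -> E;
  cinv : chart -> E -> carrier;
  chart_at : carrier -> chart }.

Section Manifold.
Context {R : realType} {E : normedModType R} (M : mfd E).

Definition mfd_open (U : set M) : Prop :=
  forall i : chart M, open (cmap i @` (cdom i `&` U)).

Definition is_manifold : Prop :=
  [/\ (forall p : M, cdom (chart_at p) p),
      (forall (i : chart M) p, cdom i p -> cinv i (cmap i p) = p),
      (forall i j : chart M, open (cmap i @` (cdom i `&` cdom j)) /\
         smooth_on (cmap i @` (cdom i `&` cdom j)) (cmap j \o cinv i)),
      (forall p q : M, p <> q -> exists U V : set M,
         [/\ mfd_open U, mfd_open V, U p, V q & U `&` V = set0]) &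
      (exists B : nat -> set M, (forall n, mfd_open (B n)) /\
         forall U p, mfd_open U -> U p -> exists n, B n p /\ B n `<=` U)].

(** T_pM is the model space: a tangent vector at [p] is given by its components
    in the chart [chart_at p]. *)
Definition tangent (p : M) : normedModType R := E.

(** [tchange i j x u]: components in chart [j] of the tangent vector at the
    point [cinv i x] that has components [u] in chart [i]. *)
Definition tchange (i j : chart M) (x u : E) : E :=
  'D_u (cmap j \o cinv i) x.

Definition vfield : Type := forall p : M, tangent p.

Definition vfield_loc (X : vfield) (i : chart M) (x : E) : E :=
  let p := cinv i x in tchange (chart_at p) i (cmap (chart_at p) p) (X p).

Definition smooth_vfield (X : vfield) : Prop :=
  forall i : chart M, smooth_on (cmap i @` cdom i) (vfield_loc X i).

Definition smooth_fun (f : M -> R) : Prop :=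
  forall i : chart M, smooth_on (cmap i @` cdom i) (f \o cinv i).

(** [X, Y] f = X (Y f) - Y (X f) *)
Definition vbracket (X Y : vfield) : vfield := fun p =>
  let c := chart_at p in
  'D_(X p) (vfield_loc Y c) (cmap c p) - 'D_(Y p) (vfield_loc X c) (cmap c p).

Definition kform (k : nat) : Type := forall p : M, ('I_k -> tangent p) -> R.

Definition kform0 k : kform k := fun _ _ => 0.

Definition kform_add k (a b : kform k) : kform k := fun p v => a p v + b p v.

Definition kform_of_fun (f : M -> R) : kform 0 := fun p _ => f p.

Definition fun_of_kform (w : kform 0) : M -> R := fun p => w p (fun _ => 0).

(** Components of the pull-back of [w] by [cinv i]. *)
Definition kform_loc k (w : kform k) (i : chart M) (x : E)
    (u : 'I_k -> E) : R :=
  let p := cinv i x in w p (fun l => tchange i (chart_at p) x (u l)).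

Definition set_arg (V : Type) k (v : 'I_k -> V) (l : 'I_k) (x : V) :
    'I_k -> V :=
  fun j => if j == l then x else v j.

Definition cons_arg (V : Type) k (x : V) (v : 'I_k -> V) : 'I_k.+1 -> V :=
  fun j => if unlift ord0 j is Some l then v l else x.

(** Smooth, fibrewise multilinear and alternating. *)
Definition is_kform k (w : kform k) : Prop :=
  [/\ (forall p v l (a : R) (x y : tangent p),
         w p (set_arg v l (a *: x + y)) =
         a * w p (set_arg v l x) + w p (set_arg v l y)),
      (forall p v (j l : 'I_k), j != l -> v j = v l -> w p v = 0) &
      (forall (i : chart M) (u : 'I_k -> E),
         smooth_on (cmap i @` cdom i) (fun x => kform_loc w i x u))].

(** (dw)(v_0, .., v_k) = \sum_l (-1)^l D_{v_l} w (v_0, .., ^v_l, .., v_k),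
    in the chart [chart_at p], with [v_0, .., v_k] extended as constants. *)
Definition ext_deriv k (w : kform k) : kform k.+1 := fun p v =>
  let c := chart_at p in
  \sum_(l < k.+1) (-1) ^+ l *
    'D_(v l) (fun x => kform_loc w c x (v \o lift l)) (cmap c p).

Definition interior_prod (X : vfield) k (w : kform k.+1) : kform k :=
  fun p v => w p (cons_arg (X p) v).

(** The derivative at time 0 of the pull-back of [w] by the flow of [X]:
    (L_X w)(v_1, .., v_k)
      = D_X w (v_1, .., v_k) + \sum_l w (v_1, .., D_{v_l} X, .., v_k),
    in the chart [chart_at p], with [v_1, .., v_k] extended as constants. *)
Definition lie_deriv (X : vfield) k (w : kform k) : kform k := fun p v =>
  let c := chart_at p in
  'D_(X p) (fun x => kform_loc w c x v) (cmap c p) +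
  \sum_(l < k) w p (set_arg v l ('D_(v l) (vfield_loc X c) (cmap c p))).

Definition vapply (X : vfield) (f : M -> R) : M -> R :=
  fun_of_kform (interior_prod X (ext_deriv (kform_of_fun f))).

Definition nondeg_form (w : kform 2) : Prop :=
  forall p (x : tangent p),
    (forall y : 'I_1 -> tangent p, w p (cons_arg x y) = 0) -> x = 0.

Definition symplectic_manifold (w : kform 2) : Prop :=
  [/\ is_manifold, is_kform w, ext_deriv w = @kform0 3 & nondeg_form w].

(** The vector field [X] such that i_X w = df; it exists and is unique if [w] is
    symplectic and [f] is smooth. *)
Definition ham_vfield (w : kform 2) (f : M -> R) : vfield :=
  xget (fun _ => 0)
    [set X : vfield | interior_prod X w = ext_deriv (kform_of_fun f)].

Definition poisson_bracket (w : kform 2) (f g : M -> R) : M -> R :=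
  vapply (ham_vfield w f) g.

End Manifold.

(** In the chart [i] of TM the vector with components [u] at [cinv i x] has
    coordinates [(x, u)]. *)
Definition TM (R : realType) (E : normedModType R) (M : mfd E) :
    mfd (E * E)%type :=
  @Mfd R (E * E)%type (carrier M * E)%type (chart M)
    (fun i => [set v | cdom i v.1])
    (fun i v => (cmap i v.1,
       tchange (chart_at v.1) i (cmap (chart_at v.1) v.1) v.2))
    (fun i xu => (cinv i xu.1,
       tchange i (chart_at (cinv i xu.1)) xu.1 xu.2))
    (fun v => chart_at v.1).

Definition tauM (R : realType) (E : normedModType R) (M : mfd E) :
    TM M -> M := fst.

Definition tmap (R : realType) (E F : normedModType R) (M : mfd E) (N : mfd F)
    (f : M -> N) : TM M -> TM N := fun v =>
  let c := chart_at v.1 in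
  (f v.1, 'D_(v.2) (cmap (chart_at (f v.1)) \o f \o cinv c) (cmap c v.1)).

Section Lifts.
Context {R : realType} {E : normedModType R} {M : mfd E}.

Definition section_of (X : vfield M) : M -> TM M := fun p => (p, X p).

(** (x, v, x', v') |-> (x, x', v, v').  No change of chart is involved, since
    all vectors at [p] have the preferred chart [chart_at p] in [TM M]. *)
Definition kM (w : TM (TM M)) : TM (TM M) :=
  ((w.1.1, w.2.1), (w.1.2, w.2.2)).

(** The base point, i.e. first component, of [kM (tmap (section_of X) v)] is
    [v]. *)
Definition complete_lift (X : vfield M) : vfield (TM M) :=
  fun v => (kM (tmap (section_of X) v)).2.

Definition iT k (w : kform M k.+1) : kform (TM M) k := fun v u =>
  w (tauM v) (cons_arg v.2 (fun l => (tmap (@tauM R E M) (v, u l)).2)).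

(** In degree at least one; i_T vanishes on functions. *)
Definition dT k (w : kform M k.+1) : kform (TM M) k.+1 :=
  kform_add (iT (ext_deriv w)) (ext_deriv (iT w)).

End Lifts.

Definition lie_algebra (R : realType) (g : lmodType R) (br : g -> g -> g) :
    Prop :=
  [/\ (forall a x y z, br (a *: x + y) z = a *: br x z + br y z),
      (forall a x y z, br z (a *: x + y) = a *: br z x + br z y),
      (forall x, br x x = 0) &
      (forall x y z, br x (br y z) + br y (br z x) + br z (br x y) = 0)].

(** Lie algebra homomorphisms from [g] to the smooth vector fields on [M]. *)
Definition lie_action (R : realType) (g : lmodType R) (br : g -> g -> g)
    (E : normedModType R) (M : mfd E) (phi : g -> vfield M) : Prop :=
  [/\ (forall x, smooth_vfield (phi x)),
      (forall a x y p, phi (a *: x + y) p = a *: phi x p + phi y p) &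
      (forall x y, phi (br x y) = vbracket (phi x) (phi y))].

Definition symplectic_action (R : realType) (g : lmodType R)
    (br : g -> g -> g) (E : normedModType R) (M : mfd E) (w : kform M 2)
    (phi : g -> vfield M) : Prop :=
  lie_action br phi /\ forall x, lie_deriv (phi x) w = @kform0 R E M 2.

(** The momentum map [J] takes values in the dual [{scalar g}] of [g]. *)
Definition hamiltonian_action (R : realType) (g : lmodType R)
    (br : g -> g -> g) (E : normedModType R) (P : mfd E) (w : kform P 2)
    (psi : g -> vfield P) (J : P -> {scalar g}) : Prop :=
  let J_ (x : g) : P -> R := fun p => J p x in
  [/\ symplectic_manifold w, lie_action br psi,
      (forall x, smooth_fun (J_ x)),
      (forall x, psi x = ham_vfield w (J_ x)) &
      (forall x y, poisson_bracket w (J_ x) (J_ y) = J_ (br x y))].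

Definition fiberwise_linear (R : realType) (g : lmodType R)
    (E : normedModType R) (M : mfd E) (J : TM M -> {scalar g}) : Prop :=
  forall (p : M) (a : R) (u v : tangent p) (x : g),
    J (p, a *: u + v) x = a * J (p, u) x + J (p, v) x.

(* Main.v *)
Require Import Defs.
From HB Require Import structures.
From mathcomp Require Import all_boot all_order all_algebra.
From mathcomp Require Import all_classical all_reals all_analysis.
From mathcomp Require Import ring.

Set Implicit Arguments.
Unset Strict Implicit.
Unset Printing Implicit Defensive.

Import Order.TTheory GRing.Theory Num.Theory.
Import numFieldNormedType.Exports.

Local Open Scope classical_set_scope.
Local Open Scope ring_scope.

(** The proof is a computation in charts. A chart of [M] induces one of [TM M],
    in which a point is a pair (x, u) and a tangent vector at it a pair (a, b).
    Write X for the components of a vector field, B_x for the bilinear form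
    given by omega at x, and D_v for directional derivatives. Then
    - i_T omega is the one-form theta(a, b) = B_x(u, a);
    - since d omega = 0, d_T omega is the exact form d theta, and the relation
      d omega (u, a, a') = 0 brings it to the shape ([dT_formula])
        d_T omega ((a, b), (a', b')) = D_u B(a, a') + B(b, a') + B(a, b');
    - the complete lift of X is X^T = (X, D_u X) ([complete_lift_loc]);
    - the momentum is c_X(x, u) = B_x(X, u) ([momentum_loc]).

    As an exact form d_T omega is closed. It is nondegenerate: testing against
    the vertical vectors (0, b') gives a = 0, and then testing against (a', 0)
    gives b = 0. Contracting it with X^T and comparing with
      d c_X (a', b') = D_a' B(X, u) + B(D_a' X, u) + B(X, b'),
    the difference vanishes by d omega (X, u, a') = 0 and
    (L_X omega)(u, a') = 0 ([complete_lift_hamiltonian]). In the same way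
    {c_X, c_Y} = d c_Y (X^T) = B([X, Y], u) is (L_X omega)(Y, u) = 0 once the
    derivatives are written out ([poisson_momentum]).

    Each definition evaluates an object at a point in the preferred chart of
    that point, but a derivative needs the components in one chart near the
    point. So the exterior derivative of one-forms, the bracket and the complete
    lift must be shown to have the same coordinate expression in every chart
    ([ext_deriv_oneform_loc], [vbracket_loc], [complete_lift_loc]). All three
    follow one pattern: differentiate the transformation rule with the product
    rule [derive_eval]; the second derivative of the transition map that appears
    is cancelled by the symmetry of second derivatives ([derive_sym]). Symmetry
    also gives d d = 0 on one-forms and [X, Y]^T = [X^T, Y^T].

    Finally [TM M] is a manifold ([TM_manifold]): its transition maps
    (x, u) |-> (f x, D_u f x) are smooth because D_u f x is a combination of the
    smooth functions D_(e_i) f with the coordinates of u as coefficients. *)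

(** * Directional derivatives *)

Section Directional.
Context {R : realType}.
Implicit Types E F G : normedModType R.

Lemma derive_linear E F (f : E -> F) x (a : R) (u v : E) : differentiable f x ->
  'D_(a *: u + v) f x = a *: 'D_u f x + 'D_v f x.
Proof. by move=> df; rewrite !deriveE// linearP. Qed.

Lemma derive_comp E F G (f : E -> F) (g : F -> G) x v :
  differentiable f x -> differentiable g (f x) ->
  'D_v (g \o f) x = 'D_('D_v f x) g (f x).
Proof.
move=> df dg.
rewrite (deriveE _ (differentiable_comp df dg)) (deriveE _ dg) (deriveE _ df).
by rewrite (diff_comp df dg).
Qed.

Lemma derive_pair E F G (f : E -> F) (g : E -> G) x v :
  differentiable f x -> differentiable g x ->
  'D_v (fun y => (f y, g y)) x = ('D_v f x, 'D_v g x).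
Proof.
move=> df dg; rewrite (deriveE _ (differentiable_pair df dg)).
by rewrite (deriveE _ dg) (deriveE _ df) diff_pair.
Qed.

Lemma derive_clin E F (L : {linear E -> F}) x v : continuous L ->
  'D_v L x = L v.
Proof.
by move=> cL; rewrite (deriveE _ (linear_differentiable _ cL)) diff_lin.
Qed.

Lemma fst_continuous E F : continuous (fst : E * F -> E).
Proof. by move=> x; apply: cvg_fst. Qed.

Lemma snd_continuous E F : continuous (snd : E * F -> F).
Proof. by move=> x; apply: cvg_snd. Qed.

(** The difference of two maps that agree near [x] is negligible at every order,
    so it is differentiable with zero differential. *)
Lemma near_eq_differentiable E F (f g : E -> F) x :
  (\near x, f x = g x) -> differentiable f x -> differentiable g x.
Proof.
move=> fg df.
have -> : g = f + (g - f) by apply/funext => y; rewrite addrC subrK.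
apply: differentiableD => //.
have e0 : (g - f) \o shift x = cst ((g - f) x) + (\0 : E -> F) +o_ 0 id.
  have fg0 : \forall y \near 0, f (y + x) = g (y + x).
    by move: fg; rewrite (near_shift 0 x) /= subr0.
  apply/eqaddoP => _/posnumP[e]; near=> y.
  have fgyx : f (y + x) = g (y + x) by near: y.
  rewrite [X in `|X| <= _](_ : _ = 0) ?normr0 ?mulr_ge0//.
  rewrite !fctE /= ?fctE.
  by rewrite fgyx (nbhs_singleton fg) /cst !subrr addr0 subrr.
apply/diff_locallyP.
have d0 : 'd (g - f) x = \0 :> (E -> F).
  by apply: (@diff_unique _ _ _ _ \0) => //; exact: cst_continuous.
by rewrite d0; split => //; exact: cst_continuous.
Unshelve. all: by end_near. Qed.

Lemma scale_is_bilinear (E : normedModType R) :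
  bilinear_for
    (GRing.Scale.Law.clone _ _ *:%R _) (GRing.Scale.Law.clone _ _ *:%R _)
    (fun (a:R) (x:E) => a *: x).
Proof.
split=> [u'|u] a x y /=; first by rewrite scalerDl scalerA.
by rewrite scalerDr !scalerA mulrC.
Qed.

Lemma differentiable_scale E F (a : E -> R) (f : E -> F) x :
  differentiable a x -> differentiable f x ->
  differentiable (fun y => a y *: f y) x.
Proof.
move=> da df.
pose Bm := bilinear_isBilinear.Build R R F F _ _ _ (scale_is_bilinear F).
pose B : {bilinear R -> F -> F} := HB.pack (fun (a:R) (x:F) => a *: x) Bm.
have cB : continuous (fun p : R * F => B p.1 p.2) by exact: scale_continuous.
apply: (differentiable_comp (differentiable_pair da df)
  (differentiable_bilin (f := B) _ cB)).
Qed.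

(** The pairing of a scalar with a vector is bilinear and continuous, so the
    Leibniz rule comes from the differential of a bilinear map. *)
Lemma derive_scale E F (a : E -> R) (f : E -> F) x v :
  differentiable a x -> differentiable f x ->
  'D_v (fun y => a y *: f y) x = 'D_v a x *: f x + a x *: 'D_v f x.
Proof.
move=> da df.
pose Bm := bilinear_isBilinear.Build R R F F _ _ _ (scale_is_bilinear F).
pose B : {bilinear R -> F -> F} := HB.pack (fun (a:R) (x:F) => a *: x) Bm.
have cB : continuous (fun p : R * F => B p.1 p.2) by exact: scale_continuous.
rewrite (deriveE _ (differentiable_scale da df)) (deriveE _ da) (deriveE _ df).
have dB := differentiable_bilin (f := B) (a x, f x) cB.
have := diff_comp (differentiable_pair da df) dB.
rewrite (diff_pair da df) (diff_bilin (f := B) _ cB).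
move=> /(congr1 (fun h => h v)) -> /=.
by rewrite addrC.
Qed.

Lemma derive_line E F (f : E -> F) x u (s : R) : differentiable f (x + s *: u) ->
  is_derive s 1 (fun s => f (x + s *: u)) ('D_u f (x + s *: u)).
Proof.
move=> df.
have dl : is_diff s (fun s => x + s *: u) (fun h => h *: u).
  have := is_diffD (is_diff_cst x s) (is_diff_scalel s u).
  by rewrite add0r.
have dl1 : differentiable (fun s : R => x + s *: u) s by apply: ex_diff.
apply: DeriveDef.
  by apply/diff_derivable; exact: (differentiable_comp dl1 df).
have := derive_comp (1 : R) dl1 df.
by rewrite (deriveE (1 : R) dl1) diff_val scale1r.
Qed.

Lemma mvt_line E (f : E -> R) x u (t : R) : 0 < t ->
  (forall s, 0 <= s <= t -> differentiable f (x + s *: u)) ->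
  exists2 s, 0 <= s <= t & f (x + t *: u) - f x = t * 'D_u f (x + s *: u).
Proof.
move=> t0 df.
have dv s : s \in `[0, t]%R -> is_derive s 1 (fun s => f (x + s *: u))
    ('D_u f (x + s *: u)).
  by rewrite in_itv /= => st; apply/derive_line/df.
have dv' s : s \in `]0, t[%R -> is_derive s 1 (fun s => f (x + s *: u))
    ('D_u f (x + s *: u)).
  by move=> sI; apply: dv; rewrite in_itv /= !ltW ?(itvP sI).
have cf : {within `[0, t], continuous (fun s => f (x + s *: u))}.
  by apply: derivable_within_continuous => s /dv [].
have [s sI] := @MVT R _ (fun s => 'D_u f (x + s *: u)) 0 t t0 dv' cf.
rewrite scale0r addr0 subr0 => E0.
exists s; first by rewrite !ltW ?(itvP sI).
by rewrite E0 mulrC.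
Qed.

(** The mixed difference is t times an increment of y |-> 'D_u f y by the mean
    value theorem along [u], hence t^2 times a mixed derivative by the mean value
    theorem along [v]. *)
Lemma second_difference E (f : E -> R) (U : set E) x u v (t : R) :
  Ck 2 U f -> 0 < t ->
  (forall s r, 0 <= s <= t -> 0 <= r <= t -> U (x + s *: u + r *: v)) ->
  exists s r, [/\ 0 <= s <= t, 0 <= r <= t &
    f (x + t *: u + t *: v) - f (x + t *: u) - f (x + t *: v) + f x =
    t * t * 'D_v (fun y => 'D_u f y) (x + s *: u + r *: v)].
Proof.
move=> [df /(_ u)[dduf _]] t0 Ux.
have t00 : 0 <= (0:R) <= t by rewrite lexx ltW.
have ttt : 0 <= t <= t by rewrite lexx ltW.
have dfx s : 0 <= s <= t -> differentiable f (x + s *: u).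
  by move=> st; apply: df; rewrite -[X in U X]addr0 -(scale0r v); exact: Ux.
have dfxt s : 0 <= s <= t -> differentiable (f \o shift (t *: v)) (x + s *: u).
  move=> st; apply: differentiable_comp; last by apply: df; exact: Ux.
  exact: (@differentiableD _ _ _ id (cst (t *: v))).
have dsh s : 0 <= s <= t ->
    'D_u (f \o shift (t *: v)) (x + s *: u) = 'D_u f (x + s *: u + t *: v).
  move=> st; rewrite derive_comp; last by apply: df; exact: Ux.
    have -> : 'D_u (shift (t *: v)) (x + s *: u) = u; last by [].
    have -> : shift (t *: v) = id + cst (t *: v) by [].
    by rewrite deriveD// derive_id derive_cst addr0.
  exact: (@differentiableD _ _ _ id (cst (t *: v))).
have [s st E1] := @mvt_line _ ((f \o shift (t *: v)) - f) x u t t0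
  (fun s st => differentiableB (dfxt s st) (dfx s st)).
have [r rt E2] := @mvt_line _ (fun y => 'D_u f y) (x + s *: u) v t t0
  (fun r rt => dduf _ (Ux s r st rt)).
exists s, r; split => //.
rewrite -mulrA -E2 -(dsh _ st) -deriveB -?E1; last 2 first.
- exact/diff_derivable/dfxt.
- exact/diff_derivable/dfx.
by rewrite !fctE /= opprB !addrA addrAC.
Qed.

End Directional.

(** * Symmetry of second derivatives *)

Section Schwarz.
Context {R : realType}.
Implicit Types E F G : normedModType R.

Lemma dist_lt_add (a b p e : R) : `|a - p| < e -> `|b - p| < e -> `|a - b| < e + e.
Proof.
move=> ap bp; rewrite -(subrKA p); apply: le_lt_trans (ler_normD _ _) _.
by apply: ltrD => //; rewrite distrC.
Qed.

(** Schwarz: the mixed difference is symmetric in [u] and [v], so by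
    [second_difference] the two mixed derivatives take a common value at points
    arbitrarily close to [x]; both are continuous at [x]. *)
Lemma derive_sym_scalar E (f : E -> R) (U : set E) x u v : open U -> U x ->
  Ck 2 U f -> 'D_u (fun y => 'D_v f y) x = 'D_v (fun y => 'D_u f y) x.
Proof.
move=> oU Ux Cf; apply: contrapT => /eqP neq.
set a := 'D_u _ x in neq; set b := 'D_v _ x in neq.
pose e := `|a - b| / 2.
have e0 : 0 < e by rewrite divr_gt0// normr_gt0 subr_eq0.
have [_ df] := Cf.
have := (df v).2 u x Ux; move=> /cvgrPdist_lt/(_ _ e0) na.
have := (df u).2 v x Ux; move=> /cvgrPdist_lt/(_ _ e0) nb.
have nU := open_nbhs_nbhs (conj oU Ux).
have [d /= d0 dP] := (nbhs_ballP x _).1 (filterI nU (filterI na nb)).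
(* The divisor bounds [`|u| + `|v|] and stays positive when both vanish; it keeps
   the intermediate points inside the ball of radius d. *)
pose t := d / 2 / (`|u| + `|v| + 1).
have n0 : 0 < `|u| + `|v| + 1 by rewrite ltr_wpDl.
have t0 : 0 < t by rewrite !divr_gt0.
have inb s r : 0 <= s <= t -> 0 <= r <= t -> ball x d (x + s *: u + r *: v).
  move=> /andP[s0 st] /andP[r0 rt]; rewrite -ball_normE /ball_ /=.
  rewrite -addrA opprD addNKr normrN.
  apply: (@le_lt_trans _ _ (t * (`|u| + `|v| + 1))); last first.
    by rewrite divfK ?gt_eqF// ltr_pdivrMr// ltr_pMr// ltr1n.
  rewrite (le_trans (ler_normD _ _))// !normrZ !ger0_norm// !mulrDr mulr1.
  by rewrite ler_wpDr ?(ltW t0)// lerD// ler_wpM2r.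
have [s [r [sI rI E1]]] := @second_difference _ _ _ _ x u v t Cf t0
  (fun s r sI rI => (dP _ (inb s r sI rI)).1).
have inb' s' r' : 0 <= s' <= t -> 0 <= r' <= t -> ball x d (x + s' *: v + r' *: u).
  by move=> sI' rI'; rewrite addrAC; exact: inb.
have [s' [r' [sI' rI' E2]]] := @second_difference _ _ _ _ x v u t Cf t0
  (fun s r sI rI => (dP _ (inb' s r sI rI)).1).
(* The two mixed differences coincide, hence so do the mixed derivatives at the
   two intermediate points. *)
have tt0 : t * t != 0 by rewrite mulf_neq0 ?gt_eqF.
have xA : x + t *: v + t *: u = x + t *: u + t *: v by rewrite addrAC.
rewrite xA in E2.
have rA (p q r0 s0 : R) : p - q - r0 + s0 = p - r0 - q + s0.
  by congr (_ + _); rewrite addrAC.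
have E12 := etrans (esym E1) (etrans (rA _ _ _ _) E2).
have Epq := mulfI tt0 E12.
have /= [_ [_ db]] := dP _ (inb s r sI rI).
have /= [_ [da _]] := dP _ (inb' s' r' sI' rI').
rewrite Epq in db.
by have := dist_lt_add da db; rewrite -splitr ltxx.
Qed.

End Schwarz.

(** * Finite-dimensional model spaces *)

Section Frames.
Context {R : realType}.
Implicit Types E F G : normedModType R.

(** Finite dimensionality in the form used here: a basis with continuous
    coordinates, which turns a directional derivative along a variable vector
    into a combination of derivatives along fixed ones. *)
Definition finite_frame E := exists (m : nat) (e : 'I_m -> E)
    (l : 'I_m -> {linear E -> R}),
  (forall i, continuous (l i)) /\ forall x, x = \sum_i l i x *: e i.

Lemma finite_frame_rV n : finite_frame 'rV[R]_n.
Proof.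
have lc (i : 'I_n) : linear (fun x : 'rV[R]_n => x ord0 i).
  by move=> a x y; rewrite !mxE.
pose l (i : 'I_n) : {linear 'rV[R]_n -> R} :=
  HB.pack (fun x : 'rV[R]_n => x ord0 i) (GRing.isLinear.Build _ _ _ _ _ (lc i)).
exists n, (fun i => delta_mx 0 i), l; split; last exact: row_sum_delta.
by move=> i; exact: coord_continuous.
Qed.

Lemma finite_frame_R : finite_frame R.
Proof.
exists 1%N, (fun=> 1), (fun=> idfun); split; first by move=> _ x; exact: cvg_id.
by move=> x; rewrite big_ord1 /= /GRing.scale /= mulr1.
Qed.

Lemma finite_frame_prod E F :
  finite_frame E -> finite_frame F -> finite_frame (E * F)%type.
Proof.
move=> [m [e [l [lc le]]]] [n [f [k [kc kf]]]].
pose d (i : 'I_(m + n)) : E * F :=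
  match fintype.split i with inl i => (e i, 0) | inr i => (0, f i) end.
pose c (i : 'I_(m + n)) : {linear (E * F)%type -> R} :=
  match fintype.split i with inl i => l i \o fst | inr i => k i \o snd end.
exists (m + n)%N, d, c; split.
  move=> i; rewrite /c; case: fintype.split => j x.
    by apply: continuous_comp; [exact: fst_continuous|exact: lc].
  by apply: continuous_comp; [exact: snd_continuous|exact: kc].
move=> [x y]; rewrite big_split_ord /=.
have -> : \sum_(i < m) c (lshift n i) (x, y) *: d (lshift n i) = (x, 0).
  under eq_bigr => i _ do rewrite /c /d (unsplitK (inl i)) /=.
  rewrite [X in (X, _)]le.
  have : forall s : seq 'I_m, \sum_(i <- s) l i x *: ((e i, 0) : E * F) =
      (\sum_(i <- s) l i x *: e i, 0).
    elim=> [|i s IH]; first by rewrite !big_nil.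
    by rewrite !big_cons IH; congr (_, _) => /=; rewrite scaler0 add0r.
  exact.
have -> : \sum_(i < n) c (rshift m i) (x, y) *: d (rshift m i) = (0, y).
  under eq_bigr => i _ do rewrite /c /d (unsplitK (inr i)) /=.
  rewrite [X in (_, X)]kf.
  have : forall s : seq 'I_n, \sum_(i <- s) k i y *: ((0, f i) : E * F) =
      (0, \sum_(i <- s) k i y *: f i).
    elim=> [|i s IH]; first by rewrite !big_nil.
    by rewrite !big_cons IH; congr (_, _) => /=; rewrite scaler0 add0r.
  exact.
by congr (_, _) => /=; rewrite ?addr0 ?add0r.
Qed.

Lemma linear_frame E F m (e : 'I_m -> E) (l : 'I_m -> E -> R) (A : E -> F) :
  (forall x, x = \sum_i l i x *: e i) ->
  (forall a u v, A (a *: u + v) = a *: A u + A v) ->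
  forall x, A x = \sum_i l i x *: A (e i).
Proof.
move=> le lA x.
have A0 : A 0 = 0.
  by have := lA (-1) 0 0; rewrite scaleN1r oppr0 addr0 scaleN1r addNr.
rewrite [in LHS](le x); elim: index_enum => [|i s IH]; first by rewrite !big_nil.
by rewrite !big_cons lA IH.
Qed.

End Frames.

(** * Calculus of smooth maps *)

Section SmoothMaps.
Context {R : realType}.
Implicit Types E F G : normedModType R.

Lemma Ck_eq E F k (U : set E) (f g : E -> F) : open U ->
  (forall x, U x -> f x = g x) -> Ck k U f -> Ck k U g.
Proof.
move=> oU; elim: k f g => [|k IH] f g fg.
  move=> cf x Ux.
  have nfg : \near x, f x = g x.
    by apply: filterS (open_nbhs_nbhs (conj oU Ux)) => y; exact: fg.
  have : g @ x --> f x by apply: cvg_trans (cf x Ux); exact: near_eq_cvg.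
  by rewrite (fg _ Ux).
move=> [df Df].
have nfg x : U x -> \near x, f x = g x.
  by move=> Ux; apply: filterS (open_nbhs_nbhs (conj oU Ux)) => y; exact: fg.
split=> [x Ux|v].
  exact: near_eq_differentiable (nfg x Ux) (df x Ux).
by apply: IH (Df v) => x Ux; exact/near_eq_derive/nfg.
Qed.

Lemma CkW E F k (U : set E) (f : E -> F) : Ck k.+1 U f -> Ck k U f.
Proof.
elim: k f => [|k IH] f [df Df].
  by move=> x Ux; exact/differentiable_continuous/df.
by split=> // v; exact: IH.
Qed.

Lemma Ck_cst E F k (U : set E) (a : F) : Ck k U (fun=> a).
Proof.
elim: k a => [|k IH] a; first by move=> x _; exact: cst_continuous.
split=> [x _|v]; first exact: differentiable_cst.
have -> : (fun x => 'D_v (fun=> a) x) = fun=> (0 : F); last exact: IH.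
by apply/funext => x; exact: derive_cst.
Qed.

Lemma Ck_clin E F k (U : set E) (L : {linear E -> F}) : continuous L ->
  Ck k U L.
Proof.
move=> cL; case: k => [|k]; first by move=> x _; exact: cL.
split=> [x _|v]; first exact: linear_differentiable.
have -> : (fun x => 'D_v L x) = fun=> L v; last exact: Ck_cst.
by apply/funext => x; exact: derive_clin.
Qed.

Lemma Ck_clin_comp E F G k (U : set E) (f : E -> F) (L : {linear F -> G}) :
  open U -> continuous L -> Ck k U f -> Ck k U (L \o f).
Proof.
move=> oU cL; elim: k f => [|k IH] f.
  by move=> cf x Ux; apply: continuous_comp; [exact: cf|exact: cL].
move=> [df Df]; split=> [x Ux|v].
  by apply: differentiable_comp; [exact: df|exact: linear_differentiable].
apply: Ck_eq (IH _ (Df v)) => // x Ux /=.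
rewrite derive_comp; [|exact: df|exact: linear_differentiable].
by rewrite derive_clin.
Qed.

Lemma Ck_add E F k (U : set E) (f g : E -> F) : open U ->
  Ck k U f -> Ck k U g -> Ck k U (fun x => f x + g x).
Proof.
move=> oU; elim: k f g => [|k IH] f g.
  by move=> cf cg x Ux; apply: continuousD; [exact: cf|exact: cg].
move=> [df Df] [dg Dg]; split=> [x Ux|v].
  by apply: differentiableD; [exact: df|exact: dg].
apply: Ck_eq (IH _ _ (Df v) (Dg v)) => // x Ux.
by rewrite -deriveD//; apply: diff_derivable; [exact: df|exact: dg].
Qed.

Lemma Ck_scale E F k (U : set E) (a : E -> R) (f : E -> F) : open U ->
  Ck k U a -> Ck k U f -> Ck k U (fun x => a x *: f x).
Proof.
move=> oU; elim: k a f => [|k IH] a f Ca Cf.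
  by move=> x Ux; apply: continuousZ; [exact: Ca|exact: Cf].
have [da Da] := Ca; have [df Df] := Cf; split=> [x Ux|v].
  by apply: differentiable_scale; [exact: da|exact: df].
apply: (@Ck_eq _ _ _ _ (fun x => 'D_v a x *: f x + a x *: 'D_v f x)) => //.
  by move=> x Ux; rewrite (derive_scale v (da x Ux) (df x Ux)).
apply: Ck_add => //; apply: IH.
- exact: Da.
- exact: CkW.
- exact: CkW.
- exact: Df.
Qed.

Lemma Ck_sum E F k m (U : set E) (f : 'I_m -> E -> F) : open U ->
  (forall i, Ck k U (f i)) -> Ck k U (fun x => \sum_i f i x).
Proof.
move=> oU Cf; elim: index_enum => [|i s IH].
  under eq_fun do rewrite big_nil.
  exact: Ck_cst.
under eq_fun do rewrite big_cons.
exact: Ck_add.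
Qed.

Lemma Ck_pair E F G k (U : set E) (f : E -> F) (g : E -> G) : open U ->
  Ck k U f -> Ck k U g -> Ck k U (fun x => (f x, g x)).
Proof.
move=> oU; elim: k f g => [|k IH] f g.
  by move=> cf cg x Ux; apply: cvg_pair; [exact: cf|exact: cg].
move=> [df Df] [dg Dg]; split=> [x Ux|v].
  by apply: differentiable_pair; [exact: df|exact: dg].
apply: Ck_eq (IH _ _ (Df v) (Dg v)) => // x Ux.
by rewrite derive_pair//; [exact: df|exact: dg].
Qed.

(** In the chain rule the direction 'D_v f x varies with x, whereas [Ck] speaks
    of fixed directions; expanding it in a frame of [F] reduces to sums of
    products, of lower order in the induction. *)
Lemma Ck_comp E F G k (U : set E) (V : set F) (f : E -> F) (g : F -> G) :
  finite_frame F -> open U -> (forall x, U x -> V (f x)) ->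
  Ck k U f -> Ck k V g -> Ck k U (g \o f).
Proof.
move=> [m [e [l [lc le]]]] oU UV; elim: k f g UV => [|k IH] f g UV Cf Cg.
  by move=> x Ux; apply: continuous_comp; [exact: Cf|exact/Cg/UV].
have [df Df] := Cf; have [dg Dg] := Cg.
split=> [x Ux|v].
  by apply: differentiable_comp; [exact: df|exact/dg/UV].
have E0 x : U x -> \sum_i l i ('D_v f x) *: 'D_(e i) g (f x) = 'D_v (g \o f) x.
  move=> Ux; rewrite (derive_comp v (df _ Ux) (dg _ (UV _ Ux))).
  rewrite -(linear_frame le (A := fun w => 'D_w g (f x)))// => a u w.
  exact/derive_linear/dg/UV.
apply: Ck_eq E0 _ => //; apply: Ck_sum => // i; apply: Ck_scale => //.
  exact: (Ck_clin_comp oU (lc i) (Df v)).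
exact: (IH f (fun y => 'D_(e i) g y) UV (CkW Cf) (Dg (e i))).
Qed.

Lemma smooth_eq E F (U : set E) (f g : E -> F) : open U ->
  (forall x, U x -> f x = g x) -> smooth_on U f -> smooth_on U g.
Proof. by move=> oU fg sf k; apply: Ck_eq (sf k). Qed.

Lemma smooth_comp E F G (U : set E) (V : set F) (f : E -> F) (g : F -> G) :
  finite_frame F -> open U -> (forall x, U x -> V (f x)) ->
  smooth_on U f -> smooth_on V g -> smooth_on U (g \o f).
Proof. by move=> fF oU UV sf sg k; apply: Ck_comp (sf k) (sg k). Qed.

Lemma smooth_derive E F (U : set E) (f : E -> F) v :
  smooth_on U f -> smooth_on U (fun x => 'D_v f x).
Proof. by move=> sf k; have [_ Df] := sf k.+1; exact: Df. Qed.

Lemma smooth_diff E F (U : set E) (f : E -> F) x :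
  smooth_on U f -> U x -> differentiable f x.
Proof. by move=> sf Ux; have [df _] := sf 1%N; exact: df. Qed.

Lemma smooth_cont E F (U : set E) (f : E -> F) x :
  smooth_on U f -> U x -> {for x, continuous f}.
Proof. by move=> sf Ux; have cf := sf 0%N; exact: cf. Qed.

Lemma smooth_cst E F (U : set E) (a : F) : smooth_on U (fun=> a).
Proof. by move=> k; exact: Ck_cst. Qed.

Lemma smooth_clin E F (U : set E) (L : {linear E -> F}) : continuous L ->
  smooth_on U L.
Proof. by move=> cL k; exact: Ck_clin. Qed.

Lemma smooth_clin_comp E F G (U : set E) (f : E -> F) (L : {linear F -> G}) :
  open U -> continuous L -> smooth_on U f -> smooth_on U (L \o f).
Proof. by move=> oU cL sf k; exact: Ck_clin_comp. Qed.

Lemma smooth_add E F (U : set E) (f g : E -> F) : open U ->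
  smooth_on U f -> smooth_on U g -> smooth_on U (fun x => f x + g x).
Proof. by move=> oU sf sg k; apply: Ck_add. Qed.

Lemma smooth_scale E F (U : set E) (a : E -> R) (f : E -> F) : open U ->
  smooth_on U a -> smooth_on U f -> smooth_on U (fun x => a x *: f x).
Proof. by move=> oU sf sg k; apply: Ck_scale. Qed.

Lemma smooth_sum E F m (U : set E) (f : 'I_m -> E -> F) : open U ->
  (forall i, smooth_on U (f i)) -> smooth_on U (fun x => \sum_i f i x).
Proof. by move=> oU sf k; apply: Ck_sum => // i; exact: sf. Qed.

Lemma smooth_pair E F G (U : set E) (f : E -> F) (g : E -> G) : open U ->
  smooth_on U f -> smooth_on U g -> smooth_on U (fun x => (f x, g x)).
Proof. by move=> oU sf sg k; apply: Ck_pair. Qed.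

(** A family of linear maps, depending on a point and applied to a vector that
    depends on the same point. With [derive_eval] this covers tangent maps,
    forms evaluated on fields and derivatives along fields. *)
Lemma smooth_eval E F G (U : set E) (A : E -> F -> G) (W : E -> F) :
  finite_frame F -> open U ->
  (forall x, U x -> forall a u v, A x (a *: u + v) = a *: A x u + A x v) ->
  (forall w, smooth_on U (fun x => A x w)) -> smooth_on U W ->
  smooth_on U (fun x => A x (W x)).
Proof.
move=> [m [e [l [lc le]]]] oU lA sA sW.
apply: (@smooth_eq _ _ _ (fun x => \sum_i l i (W x) *: A x (e i))) => //.
  by move=> x Ux; rewrite -(linear_frame le (lA x Ux)).
apply: smooth_sum => // i; apply: smooth_scale => //; exact: smooth_clin_comp.
Qed.

(** Product rule for the evaluation of a family of linear maps; no topology on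
    the space of linear maps is involved, as a frame of [F] reduces it to the
    product of a scalar and a vector. *)
Lemma derive_eval E F G (A : E -> F -> G) (W : E -> F) x h :
  finite_frame F ->
  (\near x, forall a u v, A x (a *: u + v) = a *: A x u + A x v) ->
  (forall w, differentiable (fun x => A x w) x) -> differentiable W x ->
  'D_h (fun y => A y (W y)) x =
    'D_h (fun y => A y (W x)) x + A x ('D_h W x).
Proof.
move=> [m [e [l [lc le]]]] lA dA dW.
have lAx := nbhs_singleton lA.
have E1 (V : E -> F) : 'D_h (fun y => A y (V y)) x =
    'D_h (fun y => \sum_i l i (V y) *: A y (e i)) x.
  apply: near_eq_derive; apply: filterS lA => y lAy.
  exact: (linear_frame le lAy).
have E2 (V : E -> F) : differentiable V x ->
    'D_h (fun y => \sum_i l i (V y) *: A y (e i)) x =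
    \sum_i (l i ('D_h V x) *: A x (e i) + l i (V x) *: 'D_h (fun y => A y (e i)) x).
  move=> dV.
  have dl i : differentiable (l i \o V) x.
    by apply: differentiable_comp => //; exact: linear_differentiable.
  have -> : (fun y => \sum_i l i (V y) *: A y (e i)) =
      \sum_i (fun y => l i (V y) *: A y (e i)) by rewrite fct_sumE.
  rewrite derive_sum => [|i].
    apply: eq_bigr => i _; rewrite (derive_scale h (dl i) (dA (e i))).
    rewrite (derive_comp h dV); last exact: linear_differentiable.
    by rewrite derive_clin.
  exact/diff_derivable/(differentiable_scale (dl i) (dA (e i))).
rewrite !E1 (E2 _ dW) (E2 (cst (W x))); last exact: differentiable_cst.
rewrite big_split /= addrC; congr (_ + _).
  by apply: eq_bigr => i _; rewrite derive_cst linear0 scale0r add0r.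
by rewrite -(linear_frame le lAx).
Qed.

Lemma differentiable_eval E F G (A : E -> F -> G) (W : E -> F) x :
  finite_frame F ->
  (\near x, forall a u v, A x (a *: u + v) = a *: A x u + A x v) ->
  (forall w, differentiable (fun x => A x w) x) -> differentiable W x ->
  differentiable (fun y => A y (W y)) x.
Proof.
move=> [m [e [l [lc le]]]] lA dA dW.
apply: (@near_eq_differentiable _ _ _ (fun y => \sum_i l i (W y) *: A y (e i))).
  by apply: filterS lA => y lAy; rewrite -(linear_frame le lAy).
rewrite -(fct_sumE _ _ (fun i y => l i (W y) *: A y (e i))).
apply: differentiable_sum => i.
apply: differentiable_scale => //.
by apply: differentiable_comp => //; exact: linear_differentiable.
Qed.

(** The coordinates of a frame of [F] separate points and commute with
    derivatives, which reduces to scalar functions. *)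
Lemma derive_sym E F (f : E -> F) (U : set E) x u v : finite_frame F ->
  open U -> U x -> smooth_on U f ->
  'D_u (fun y => 'D_v f y) x = 'D_v (fun y => 'D_u f y) x.
Proof.
move=> [m [e [l [lc le]]]] oU Ux sf.
have l_inj (a b : F) : (forall i, l i a = l i b) -> a = b.
  by move=> ab; rewrite (le a) (le b); apply: eq_bigr => i _; rewrite ab.
apply: l_inj => i.
have dl y : differentiable (l i) y by exact: linear_differentiable.
have dD w : differentiable (fun y => 'D_w f y) x.
  by apply: smooth_diff Ux; exact: smooth_derive.
have lD w w' : l i ('D_w (fun y => 'D_w' f y) x) =
    'D_w (fun y => 'D_w' (l i \o f) y) x.
  transitivity ('D_w (l i \o (fun y => 'D_w' f y)) x).
    by rewrite (derive_comp w (dD w')) ?derive_clin.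
  apply: near_eq_derive; apply: filterS (open_nbhs_nbhs (conj oU Ux)) => y Uy.
  by rewrite /= (derive_comp w' (smooth_diff sf Uy)) ?derive_clin.
apply: etrans (lD _ _) (etrans _ (esym (lD _ _))).
have C2 := smooth_clin_comp oU (lc i) sf 2%N.
exact: (derive_sym_scalar u v oU Ux C2).
Qed.

End SmoothMaps.

(** * Tangent maps in a chart *)

Section Tangent.
Context {R : realType}.
Implicit Types E F G : normedModType R.

Lemma open_tube E F (U : set E) : open U -> open [set v : E * F | U v.1].
Proof.
move=> oU; apply: (@open_comp _ _ (fst : E * F -> E)) => //.
by move=> x _; exact: fst_continuous.
Qed.

Lemma smooth_fst E F (U : set (E * F)) : smooth_on U fst.
Proof. by apply: smooth_clin; exact: fst_continuous. Qed.

Lemma smooth_snd E F (U : set (E * F)) : smooth_on U snd.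
Proof. by apply: smooth_clin; exact: snd_continuous. Qed.

Lemma smooth_tube E F (U : set E) (f : E -> F) : finite_frame E ->
  open U -> smooth_on U f ->
  smooth_on [set v : E * E | U v.1] (fun v => f v.1).
Proof.
move=> fE oU sf; apply: (smooth_comp fE (open_tube oU) _ _ sf) => //.
exact: smooth_fst.
Qed.

(** The tangent map (x, u) |-> 'D_u f x is smooth on the whole tube over [U];
    this is what makes [TM M] a manifold. *)
Lemma smooth_tangent E F (U : set E) (f : E -> F) : finite_frame E ->
  open U -> smooth_on U f ->
  smooth_on [set v : E * E | U v.1] (fun v => 'D_(v.2) f v.1).
Proof.
move=> fE oU sf.
apply: (smooth_eval (A := fun v w => 'D_w f v.1) fE (open_tube oU)).
- by move=> v Uv a u w; apply: derive_linear; exact: smooth_diff sf Uv.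
- by move=> w; exact: (smooth_tube fE oU (smooth_derive w sf)).
- exact: smooth_snd.
Qed.

Lemma differentiable_fst E F (v : E * F) : differentiable (fst : E * F -> E) v.
Proof. by apply: linear_differentiable; exact: fst_continuous. Qed.

Lemma derive_fst E F G (f : E -> G) (v h : E * F) : differentiable f v.1 ->
  'D_h (fun v : E * F => f v.1) v = 'D_(h.1) f v.1.
Proof.
move=> df; rewrite (derive_comp h (differentiable_fst v) df); congr ('D_ _ f _).
by apply: derive_clin; exact: fst_continuous.
Qed.

Lemma derive_tangent E F (U : set E) (f : E -> F) (v h : E * E) :
  finite_frame E -> open U -> U v.1 -> smooth_on U f ->
  'D_h (fun v => 'D_(v.2) f v.1) v =
    'D_(h.1) (fun x => 'D_(v.2) f x) v.1 + 'D_(h.2) f v.1.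
Proof.
move=> fE oU Uv sf.
have sD w : differentiable (fun y => 'D_w f y) v.1.
  by apply: smooth_diff Uv; exact: smooth_derive.
rewrite (derive_eval (A := fun v w => 'D_w f v.1) h fE).
- rewrite (derive_fst h (sD v.2)); congr (_ + 'D__ f _).
  by apply: derive_clin; exact: snd_continuous.
- apply: filterS (open_nbhs_nbhs (conj (open_tube (F := E) oU) Uv)) => y Uy a u w.
  by apply: derive_linear; exact: smooth_diff sf Uy.
- by move=> w; exact: (differentiable_comp (differentiable_fst v) (sD w)).
- by apply: linear_differentiable; exact: snd_continuous.
Qed.

End Tangent.

(** * Changes of chart *)

(** The common term [s] stands for a second derivative of a transition map: it
    enters both halves of an antisymmetric expression and drops out. *)
Lemma subr_common (V : zmodType) (a b s t u v : V) :
  a = s + u -> b = t + v -> s = t -> a - b = u - v.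
Proof. by move=> -> -> ->; rewrite opprD addrACA subrr add0r. Qed.

Section Atlas.
Context {R : realType} {E : normedModType R}.

(** The part of [is_manifold] on which differential calculus rests; it is
    established for [TM M] before the two topological axioms, whose proofs for
    [TM M] use it. *)
Definition is_atlas (M : mfd E) : Prop :=
  [/\ (forall p : M, cdom (chart_at p) p),
      (forall (i : chart M) p, cdom i p -> cinv i (cmap i p) = p) &
      (forall i j : chart M, open (cmap i @` (cdom i `&` cdom j)) /\
         smooth_on (cmap i @` (cdom i `&` cdom j)) (cmap j \o cinv i))].

Lemma manifold_atlas (M : mfd E) : is_manifold M -> is_atlas M.
Proof. by case. Qed.

Context (fE : finite_frame E) (M : mfd E) (hM : is_atlas M).
Implicit Types (i j k : chart M) (p : M) (x : E).

Lemma chart_atP p : cdom (chart_at p) p. Proof. by have [] := hM. Qed.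

Lemma cmapK i p : cdom i p -> cinv i (cmap i p) = p.
Proof. by have [_ + _] := hM; apply. Qed.

Lemma cdom_cinv i x : (cmap i @` cdom i) x -> cdom i (cinv i x).
Proof. by move=> [p ip <-]; rewrite cmapK. Qed.

Lemma cinvK i x : (cmap i @` cdom i) x -> cmap i (cinv i x) = x.
Proof. by move=> [p ip <-]; rewrite cmapK. Qed.

Lemma chart_image i p : cdom i p -> (cmap i @` cdom i) (cmap i p).
Proof. by move=> ip; exists p. Qed.

Lemma chart_open i : open (cmap i @` cdom i).
Proof. by have [_ _ /(_ i i)[+ _]] := hM; rewrite setIid. Qed.

Lemma overlap_open i j : open (cmap i @` (cdom i `&` cdom j)).
Proof. by have [_ _ /(_ i j)[]] := hM. Qed.

Lemma overlapP i j x : (cmap i @` cdom i) x -> cdom j (cinv i x) ->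
  (cmap i @` (cdom i `&` cdom j)) x.
Proof.
move=> ix jx; exists (cinv i x); last exact: cinvK.
by split => //; exact: cdom_cinv.
Qed.

Lemma overlap_im i j x : (cmap i @` (cdom i `&` cdom j)) x ->
  (cmap i @` cdom i) x /\ cdom j (cinv i x).
Proof. by move=> [p [ip jp] <-]; rewrite cmapK//; split => //; exists p. Qed.

Lemma overlap_nbhs i j x : (cmap i @` cdom i) x -> cdom j (cinv i x) ->
  \near x, (cmap i @` cdom i) x /\ cdom j (cinv i x).
Proof.
move=> ix jx.
apply: filterS (open_nbhs_nbhs (conj (@overlap_open i j) (overlapP ix jx))) => y.
exact: overlap_im.
Qed.

Lemma trans_smooth i j :
  smooth_on (cmap i @` (cdom i `&` cdom j)) (cmap j \o cinv i).
Proof. by have [_ _ /(_ i j)[]] := hM. Qed.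

Lemma trans_diff i j x : (cmap i @` cdom i) x -> cdom j (cinv i x) ->
  differentiable (cmap j \o cinv i) x.
Proof. by move=> ix jx; apply: smooth_diff (@trans_smooth i j) _; exact: overlapP. Qed.

Lemma tchange_linear i j x a u v : (cmap i @` cdom i) x -> cdom j (cinv i x) ->
  tchange i j x (a *: u + v) = a *: tchange i j x u + tchange i j x v.
Proof. by move=> ix jx; apply: derive_linear; exact: trans_diff. Qed.

Lemma tchangeB i j x u v : (cmap i @` cdom i) x -> cdom j (cinv i x) ->
  tchange i j x (u - v) = tchange i j x u - tchange i j x v.
Proof.
move=> ix jx; have := tchange_linear (-1) v u ix jx.
by rewrite !scaleN1r addrC => ->; rewrite addrC.
Qed.

(** Functoriality of tangent maps, with the cocycle rule of transition maps. *)
Lemma tchange_comp i j k x u :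
  (cmap i @` cdom i) x -> cdom j (cinv i x) -> cdom k (cinv i x) ->
  tchange j k (cmap j (cinv i x)) (tchange i j x u) = tchange i k x u.
Proof.
move=> ix jx kx.
have dj := trans_diff ix jx.
have jy : (cmap j @` cdom j) (cmap j (cinv i x)) by exists (cinv i x).
have dk : differentiable (cmap k \o cinv j) ((cmap j \o cinv i) x).
  by apply: trans_diff => //=; rewrite cmapK.
rewrite /tchange -(derive_comp u dj dk).
apply: near_eq_derive; apply: filterS (overlap_nbhs ix jx) => y [_ jy'].
by rewrite /= cmapK.
Qed.

Lemma tchange_id i x u : (cmap i @` cdom i) x -> tchange i i x u = u.
Proof.
move=> ix; rewrite /tchange -[RHS](derive_id x u).
apply: near_eq_derive; apply: filterS (overlap_nbhs ix (cdom_cinv ix)) => y [iy _].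
by rewrite /= cinvK.
Qed.

Lemma tchange_comp_at i j k p u : cdom i p -> cdom j p -> cdom k p ->
  tchange j k (cmap j p) (tchange i j (cmap i p) u) = tchange i k (cmap i p) u.
Proof.
move=> ip jp kp.
by have := @tchange_comp i j k (cmap i p) u (chart_image ip); rewrite cmapK//; apply.
Qed.

Lemma tchangeK i j p u : cdom i p -> cdom j p ->
  tchange j i (cmap j p) (tchange i j (cmap i p) u) = u.
Proof. by move=> ip jp; rewrite tchange_comp_at// tchange_id//; exists p. Qed.

Lemma vfield_loc_at (X : vfield M) p :
  vfield_loc X (chart_at p) (cmap (chart_at p) p) = X p.
Proof.
have cp := chart_atP p.
by rewrite /vfield_loc cmapK// tchange_id//; exists p.
Qed.

Lemma vfield_loc_change (X : vfield M) i j x :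
  (cmap i @` cdom i) x -> cdom j (cinv i x) ->
  vfield_loc X j (cmap j (cinv i x)) = tchange i j x (vfield_loc X i x).
Proof.
move=> ix jx; rewrite /vfield_loc cmapK//.
have := tchange_comp_at (X (cinv i x)) (chart_atP (cinv i x)) (cdom_cinv ix) jx.
by rewrite cinvK.
Qed.

Lemma kform_loc_at d (w : kform M d) p v :
  kform_loc w (chart_at p) (cmap (chart_at p) p) v = w p v.
Proof.
have cp := chart_atP p.
rewrite /kform_loc cmapK//; congr (w p _); apply/funext => l.
by rewrite tchange_id//; exists p.
Qed.

Lemma kform_loc_change d (w : kform M d) i j x u :
  (cmap i @` cdom i) x -> cdom j (cinv i x) ->
  kform_loc w j (cmap j (cinv i x)) (fun l => tchange i j x (u l)) =
  kform_loc w i x u.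
Proof.
move=> ix jx; rewrite /kform_loc cmapK//; congr (w _ _); apply/funext => l.
by rewrite tchange_comp//; exact: chart_atP.
Qed.

(** The derivative of the rule Y_i (f z) = 'D_(Y_c z) f z, for f the transition
    map from [c] to [i]. The first term is the obstruction to the derivative of a
    vector field being a tensor. *)
Lemma derive_vfield_loc (Y : vfield M) c i y h : smooth_vfield Y ->
  (cmap c @` cdom c) y -> cdom i (cinv c y) ->
  'D_(tchange c i y h) (vfield_loc Y i) (cmap i (cinv c y)) =
  'D_h (fun z => 'D_(vfield_loc Y c y) (cmap i \o cinv c) z) y +
  tchange c i y ('D_h (vfield_loc Y c) y).
Proof.
move=> sY cy iy.
have oy := overlapP cy iy; have sphi := @trans_smooth c i.
have dY : differentiable (vfield_loc Y c) y by apply: smooth_diff (sY c) cy.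
have dYi : differentiable (vfield_loc Y i) ((cmap i \o cinv c) y).
  by apply: smooth_diff (sY i) _; exists (cinv c y).
have lA : \near y, forall a u v,
    'D_(a *: u + v) (cmap i \o cinv c) y =
    a *: 'D_u (cmap i \o cinv c) y + 'D_v (cmap i \o cinv c) y.
  apply: filterS (overlap_nbhs cy iy) => z [cz iz] a u v.
  exact: tchange_linear.
have dA w : differentiable (fun z => 'D_w (cmap i \o cinv c) z) y.
  exact: (smooth_diff (smooth_derive w sphi) oy).
apply: etrans _ (derive_eval (A := fun z w => 'D_w (cmap i \o cinv c) z)
  _ fE lA dA dY).
apply: etrans (esym (derive_comp h (trans_diff cy iy) dYi)) _.
apply: near_eq_derive; apply: filterS (overlap_nbhs cy iy) => z [cz iz].
by rewrite /= vfield_loc_change.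
Qed.

(** By [derive_vfield_loc] the two halves of the bracket fail to transform as
    vectors by the same second derivative of the transition map. *)
Lemma vbracket_loc (X Y : vfield M) i x : smooth_vfield X -> smooth_vfield Y ->
  (cmap i @` cdom i) x ->
  vfield_loc (vbracket X Y) i x =
  'D_(vfield_loc X i x) (vfield_loc Y i) x -
  'D_(vfield_loc Y i x) (vfield_loc X i) x.
Proof.
move=> sX sY ix.
pose p := cinv i x; pose c := chart_at p; pose y := cmap c p.
have ip : cdom i p by exact: cdom_cinv.
have cp : cdom c p by exact: chart_atP.
have cy : (cmap c @` cdom c) y by exists p.
have yp : cinv c y = p by exact: cmapK.
have iy : cdom i (cinv c y) by rewrite yp.
have yx : cmap i (cinv c y) = x by rewrite yp cinvK.
have main (X' Y' : vfield M) : smooth_vfield Y' ->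
    'D_(vfield_loc X' i x) (vfield_loc Y' i) x =
    'D_(vfield_loc X' c y) (fun z => 'D_(vfield_loc Y' c y) (cmap i \o cinv c) z) y +
    tchange c i y ('D_(vfield_loc X' c y) (vfield_loc Y' c) y).
  move=> sY'; have := derive_vfield_loc (vfield_loc X' c y) sY' cy iy.
  by rewrite -(vfield_loc_change X' cy iy) yx.
have sym := derive_sym (vfield_loc X c y) (vfield_loc Y c y) fE
  (@overlap_open c i) (overlapP cy iy) (@trans_smooth c i).
apply: etrans (esym (subr_common (main X Y sY) (main Y X sX) sym)).
apply: etrans _ (tchangeB (i := c) (j := i) _ _ cy iy).
apply: (congr1 (tchange c i y)).
by rewrite /vbracket -/c -/y -(vfield_loc_at X) -(vfield_loc_at Y).
Qed.

End Atlas.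

(** * The exterior derivative of one-forms *)

Lemma alternating_sum2 (A : pzRingType) (F : 'I_2 -> A) :
  \sum_(l < 2) (-1) ^+ l * F l = F ord0 - F (lift ord0 ord0).
Proof.
by rewrite !big_ord_recl big_ord0 addr0 /= expr0 mul1r expr1 mulN1r.
Qed.

Lemma alternating_sum3 (A : pzRingType) (F : 'I_3 -> A) :
  \sum_(l < 3) (-1) ^+ l * F l =
  F ord0 - F (lift ord0 ord0) + F (lift ord0 (lift ord0 ord0)).
Proof.
rewrite !big_ord_recl big_ord0 addr0 /= expr0 mul1r expr1 mulN1r.
by rewrite expr2 mulrNN mulr1 mul1r addrA.
Qed.

Lemma subr_common_r (V : zmodType) (a b s t u v : V) :
  a = u + s -> b = v + t -> s = t -> a - b = u - v.
Proof. by rewrite [u + s]addrC [v + t]addrC; exact: subr_common. Qed.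

Lemma ord2P (l : 'I_2) : l = ord0 \/ l = lift ord0 ord0.
Proof. by case: l => -[|[|//]] ?; [left|right]; exact/val_inj. Qed.

Section OneForms.
Context {R : realType} {E : normedModType R}.
Context (fE : finite_frame E) (M : mfd E) (hM : is_atlas M).
Context (w : kform M 1) (hw : is_kform w).
Implicit Types (i j : chart M) (p : M) (x a b : E).

Definition oneform_loc i x a : R := kform_loc w i x (fun=> a).

Lemma oneform_loc_linear i x : (cmap i @` cdom i) x -> forall (s : R) a b,
  oneform_loc i x (s *: a + b) = s *: oneform_loc i x a + oneform_loc i x b.
Proof.
move=> ix s a b; rewrite /oneform_loc /kform_loc.
set p := cinv i x.
have cp : cdom (chart_at p) (cinv i x) by exact: chart_atP.
have eta (y : E) : (fun=> y) = set_arg (fun _ : 'I_1 => 0 : E) ord0 y.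
  by apply/funext => l; rewrite /set_arg (ord1 l).
have [lw _ _] := hw.
rewrite (eta (tchange i _ x (s *: a + b))) (tchange_linear hM _ _ _ ix cp) lw.
by rewrite -!eta.
Qed.

Lemma oneform_loc_smooth i a :
  smooth_on (cmap i @` cdom i) (fun x => oneform_loc i x a).
Proof. by have [_ _ sw] := hw; exact: sw. Qed.

Lemma oneform_loc_change i j x a :
  (cmap i @` cdom i) x -> cdom j (cinv i x) ->
  oneform_loc j (cmap j (cinv i x)) (tchange i j x a) = oneform_loc i x a.
Proof. by move=> ix jx; rewrite /oneform_loc -(kform_loc_change hM _ _ ix jx). Qed.

Definition oneform_curl i x a b : R :=
  'D_a (fun z => oneform_loc i z b) x - 'D_b (fun z => oneform_loc i z a) x.

Lemma ext_deriv_oneform p (v : 'I_2 -> tangent p) : ext_deriv w v =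
  oneform_curl (chart_at p) (cmap (chart_at p) p) (v ord0) (v (lift ord0 ord0)).
Proof.
pose c := chart_at p.
have e0 : (fun x => kform_loc w c x (v \o lift ord0)) =
    (fun z => oneform_loc c z (v (lift ord0 ord0))).
  apply/funext => z; rewrite /oneform_loc; congr (kform_loc _ _ _ _).
  by apply/funext => l /=; rewrite (ord1 l).
have e1 : (fun x => kform_loc w c x (v \o lift (lift ord0 ord0))) =
    (fun z => oneform_loc c z (v ord0)).
  apply/funext => z; rewrite /oneform_loc; congr (kform_loc _ _ _ _).
  by apply/funext => l /=; rewrite (ord1 l); congr v; exact/val_inj.
apply: etrans (alternating_sum2 _) _.
exact: (congr2 (fun f g => 'D_(v ord0) f (cmap c p) -
  'D_(v (lift ord0 ord0)) g (cmap c p)) e0 e1).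
Qed.

(** Differentiating the rule theta_i(z)(b) = theta_c(f z)('D_b f z) yields, besides
    the transformed derivative, theta_c applied to a second derivative of f; the
    latter is symmetric and disappears from the curl. *)
Lemma ext_deriv_oneform_loc i x u : (cmap i @` cdom i) x ->
  kform_loc (ext_deriv w) i x u = oneform_curl i x (u ord0) (u (lift ord0 ord0)).
Proof.
move=> ix; rewrite /kform_loc ext_deriv_oneform.
set p := cinv i x; set c := chart_at p; set y := cmap c p.
have cx : cdom c (cinv i x) by exact: chart_atP.
have cy : (cmap c @` cdom c) y by exists p.
have oc := @overlap_open _ _ _ hM i c.
have ox := overlapP hM ix cx.
have sphi := @trans_smooth _ _ _ hM i c.
have main a b : 'D_a (fun z => oneform_loc i z b) x =
   'D_(tchange i c x a) (fun z => oneform_loc c z (tchange i c x b)) y +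
   oneform_loc c y ('D_a (fun z => 'D_b (cmap c \o cinv i) z) x).
  have lA : \near x, forall (s : R) u v,
      oneform_loc c (cmap c (cinv i x)) (s *: u + v) =
      s *: oneform_loc c (cmap c (cinv i x)) u + oneform_loc c (cmap c (cinv i x)) v.
    apply: filterS (overlap_nbhs hM ix cx) => z [iz cz].
    by apply: oneform_loc_linear; exists (cinv i z).
  have dphi := trans_diff hM ix cx.
  have dw a' : differentiable (fun z => oneform_loc c z a') ((cmap c \o cinv i) x).
    by apply: smooth_diff (oneform_loc_smooth c a') cy.
  have dA a' : differentiable (fun z => oneform_loc c (cmap c (cinv i z)) a') x.
    exact: (differentiable_comp dphi (dw a')).
  have dW : differentiable (fun z => 'D_b (cmap c \o cinv i) z) x.
    exact: (smooth_diff (smooth_derive b sphi) ox).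
  apply: etrans (etrans _ (derive_eval
    (A := fun z a' => oneform_loc c (cmap c (cinv i z)) a') a fE lA dA dW)) _.
    apply: near_eq_derive; apply: filterS (overlap_nbhs hM ix cx) => z [iz cz].
    exact: esym (oneform_loc_change _ iz cz).
  apply: (f_equal2 +%R _ erefl).
  exact: (derive_comp a dphi (dw (tchange i c x b))).
have sym a b : oneform_loc c y ('D_a (fun z => 'D_b (cmap c \o cinv i) z) x) =
    oneform_loc c y ('D_b (fun z => 'D_a (cmap c \o cinv i) z) x).
  exact: (congr1 (oneform_loc c y) (derive_sym a b fE oc ox sphi)).
exact: esym (subr_common_r (main _ _) (main _ _) (sym _ _)).
Qed.

Lemma curl_anti i x a b : oneform_curl i x b a = - oneform_curl i x a b.
Proof. by rewrite /oneform_curl opprB. Qed.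

Lemma curl_linear i x (s : R) a b c : (cmap i @` cdom i) x ->
  oneform_curl i x (s *: a + b) c = s * oneform_curl i x a c + oneform_curl i x b c.
Proof.
move=> ix; rewrite /oneform_curl.
have dw a' : differentiable (fun z => oneform_loc i z a') x.
  exact: smooth_diff (oneform_loc_smooth i a') ix.
rewrite (derive_linear _ _ _ (dw c)).
have -> : 'D_c (fun z => oneform_loc i z (s *: a + b)) x =
    s *: 'D_c (fun z => oneform_loc i z a) x + 'D_c (fun z => oneform_loc i z b) x.
  rewrite -deriveZ; last exact/diff_derivable.
  rewrite -deriveD; [|exact/diff_derivable/differentiableZ|exact/diff_derivable].
  apply: near_eq_derive.
  apply: filterS (open_nbhs_nbhs (conj (@chart_open _ _ _ hM i) ix)) => z iz.
  exact: oneform_loc_linear.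
by rewrite opprD addrACA -scalerBr.
Qed.

Lemma ext_deriv_is_kform : is_kform (ext_deriv w).
Proof.
split.
- move=> p v l s x y; rewrite !ext_deriv_oneform.
  have cx : (cmap (chart_at p) @` cdom (chart_at p)) (cmap (chart_at p) p).
    by exists p => //; exact: chart_atP.
  have [->|->] := ord2P l; first by rewrite /set_arg /=; exact: curl_linear.
  rewrite /set_arg /= curl_anti curl_linear// opprD -mulrN.
  by congr (_ * _ + _); rewrite -curl_anti.
- move=> p v j l jl vjl; rewrite ext_deriv_oneform.
  have -> : v (lift ord0 ord0) = v ord0.
    case: (ord2P j) (ord2P l) jl vjl => -> [] -> //; by rewrite eqxx.
  by rewrite /oneform_curl subrr.
- move=> i u.
  apply: (@smooth_eq _ _ _ _ (fun x => oneform_curl i x (u ord0) (u (lift ord0 ord0)))).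
  + exact: chart_open.
  + by move=> x ix; rewrite ext_deriv_oneform_loc.
  rewrite /oneform_curl.
  have -> : (fun x => 'D_(u ord0) (fun z => oneform_loc i z (u (lift ord0 ord0))) x -
      'D_(u (lift ord0 ord0)) (fun z => oneform_loc i z (u ord0)) x) =
    (fun x => 'D_(u ord0) (fun z => oneform_loc i z (u (lift ord0 ord0))) x +
      (-1) *: 'D_(u (lift ord0 ord0)) (fun z => oneform_loc i z (u ord0)) x).
    by apply/funext => x; rewrite scaleN1r.
  have oi := @chart_open _ _ _ hM i.
  apply: (smooth_add oi); first exact: smooth_derive (oneform_loc_smooth _ _).
  apply: (smooth_scale oi); first exact: smooth_cst.
  exact: smooth_derive (oneform_loc_smooth _ _).
Qed.

(** By [ext_deriv_oneform_loc] the differential may be computed with the curl in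
    one fixed chart near the point; the six second derivatives then cancel in
    pairs. *)
Lemma ext_derivK_oneform : ext_deriv (ext_deriv w) = @kform0 R E M 3.
Proof.
apply: functional_extensionality_dep => p; apply/funext => v.
pose c := chart_at p; pose y := cmap c p.
have cy : (cmap c @` cdom c) y by exists p => //; exact: chart_atP.
have oc := @chart_open _ _ _ hM c.
pose DD a b e : R := 'D_a (fun z => 'D_b (fun z => oneform_loc c z e) z) y.
have dD a b : differentiable (fun z => 'D_a (fun z => oneform_loc c z b) z) y.
  exact: (smooth_diff (smooth_derive a (oneform_loc_smooth c b)) cy).
have sym a b e : DD a b e = DD b a e.
  exact: (derive_sym a b finite_frame_R oc cy (oneform_loc_smooth c e)).
pose F (l : 'I_3) : R := 'D_(v l) (fun z => kform_loc (ext_deriv w) c z (v \o lift l)) y.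
have main (l l0 l1 : 'I_3) : lift l (ord0 : 'I_2) = l0 ->
    lift l (lift ord0 ord0 : 'I_2) = l1 ->
    F l = DD (v l) (v l0) (v l1) - DD (v l) (v l1) (v l0).
  move=> <- <-; apply: etrans _ (deriveB (diff_derivable (dD _ _))
    (diff_derivable (dD _ _))).
  apply: near_eq_derive; apply: filterS (open_nbhs_nbhs (conj oc cy)) => z cz.
  exact: ext_deriv_oneform_loc.
apply: etrans (alternating_sum3 F) _; rewrite /kform0.
rewrite (main ord0 _ _ erefl erefl).
rewrite (main (lift ord0 ord0) ord0 (lift ord0 (lift ord0 ord0))); try exact/val_inj.
rewrite (main (lift ord0 (lift ord0 ord0)) ord0 (lift ord0 ord0)); try exact/val_inj.
set v0 := v ord0; set v1 := v (lift ord0 ord0).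
set v2 := v (lift ord0 (lift ord0 ord0)).
rewrite (sym v1 v0) (sym v2 v0) (sym v2 v1).
move: (DD v0 v1 v2) (DD v0 v2 v1) (DD v1 v2 v0) => q r s.
by rewrite opprB [q - r + _]addrC !subrKA subrr.
Qed.

End OneForms.

(** * The tangent bundle is a manifold *)

Definition countable_base (T : topologicalType) := exists C : nat -> set T,
  (forall n, open (C n)) /\
  forall U x, open U -> U x -> exists n, C n x /\ C n `<=` U.

(** Balls of radius 1/(k+1) centred at rational points. *)
Lemma countable_base_rV (R : realType) n : countable_base 'rV[R]_n.
Proof.
pose b (qk : 'rV[rat]_n * nat) : set 'rV[R]_n :=
  ball (map_mx ratr qk.1 : 'rV[R]_n) (qk.2.+1%:R^-1 : R).
exists (fun N => if unpickle N is Some qk then b qk else set0); split.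
  by move=> N; case: unpickle => [qk|]; [exact: ball_open|exact: open0].
move=> U x oU Ux.
have [e /= e0 eU] := (nbhs_ballP x _).1 (open_nbhs_nbhs (conj oU Ux)).
have [k ke] : exists k, k.+1%:R^-1 < e / 2.
  have /ltr_add_invr[k] : 0 < e / 2 by rewrite divr_gt0.
  by rewrite add0r; exists k.
have k0 : 0 < k.+1%:R^-1 :> R by rewrite invr_gt0.
have /choice [q qx] : forall j : 'I_n, exists q : rat,
    `|ratr q - x ord0 j| < k.+1%:R^-1.
  move=> j.
  have /rat_in_itvoo[q] : x ord0 j < x ord0 j + k.+1%:R^-1 by rewrite ltrDl.
  rewrite in_itv /= => /andP[q1 q2]; exists q.
  by rewrite gtr0_norm ?subr_gt0// ltrBlDl.
have bx : ball (map_mx ratr (\row_j q j) : 'rV[R]_n) k.+1%:R^-1 x.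
  split => // i j; rewrite !mxE (ord1 i) -ball_normE /ball_ /=; exact: qx.
exists (pickle (\row_j q j, k)); rewrite pickleK; split => // y.
rewrite /b /= => yq; apply: eU; apply: (@ball_split _ _ (map_mx ratr (\row_j q j) : 'rV[R]_n)).
  by apply: le_ball (ball_sym bx); exact: ltW.
by apply: le_ball yq; exact: ltW.
Qed.

Section ChartOpen.
Context {R : realType} {E : normedModType R} (M : mfd E) (hM : is_atlas M).

Lemma mfd_open_cdom (j : chart M) : mfd_open (cdom j).
Proof. by move=> i; exact: overlap_open. Qed.

(** Although openness is tested in all charts, a set lying in the domain of one
    chart can be tested there, by continuity of the transition maps. *)
Lemma mfd_open_chart (j : chart M) (W : set E) : open W ->
  mfd_open (cdom j `&` cmap j @^-1` W).
Proof.
move=> oW i.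
have -> : cmap i @` (cdom i `&` (cdom j `&` cmap j @^-1` W)) =
    (cmap i @` (cdom i `&` cdom j)) `&` (cmap j \o cinv i) @^-1` W.
  apply/seteqP; split => [x [p [ip [jp Wp]] <-]|x [[p [ip jp] <-]]].
    by split; [exists p|rewrite /= (cmapK hM)].
  by rewrite /= (cmapK hM) // => Wp; exists p.
rewrite openE => x [ox Wx]; apply: filterI.
  by apply: open_nbhs_nbhs; split => //; exact: overlap_open.
have := smooth_cont (@trans_smooth _ _ _ hM i j) ox.
by apply; apply: open_nbhs_nbhs.
Qed.

End ChartOpen.

Section TangentManifold.
Context {R : realType} {E : normedModType R}.
Context (fE : finite_frame E) (M : mfd E) (hM : is_atlas M).
Implicit Types (i j : chart M).

Lemma TM_cmapK i (v : TM M) : cdom i v.1 ->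
  cinv (i : chart (TM M)) (cmap (i : chart (TM M)) v) = v.
Proof.
case: v => p u /= ip; rewrite (cmapK hM)//; congr (_, _).
by rewrite (tchangeK hM)//; exact: chart_atP.
Qed.

Lemma TM_cinvK i (z : E * E) : (cmap i @` cdom i) z.1 ->
  cmap (i : chart (TM M)) (cinv (i : chart (TM M)) z) = z.
Proof.
case: z => x u /= ix; rewrite (cinvK hM)//; congr (_, _).
have cx := chart_atP hM (cinv i x).
by rewrite (tchange_comp hM _ ix cx (cdom_cinv hM ix)) (tchange_id hM).
Qed.

(** The charts of [TM M] map fibres onto the whole model space. *)
Lemma TM_image i (A : set M) :
  cmap (i : chart (TM M)) @` (cdom (i : chart (TM M)) `&` [set v | A v.1]) =
  [set z | (cmap i @` (cdom i `&` A)) z.1].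
Proof.
apply/seteqP; split => [z [v [iv Av] <-]|z /= [p [ip Ap] pz]].
  by exists v.1.
have ix : (cmap i @` cdom i) z.1 by exists p.
exists (cinv (i : chart (TM M)) z); last exact: TM_cinvK.
by split; rewrite /= -pz (cmapK hM).
Qed.

Lemma TM_chart_image i :
  cmap (i : chart (TM M)) @` cdom (i : chart (TM M)) =
  [set z | (cmap i @` cdom i) z.1].
Proof. by have := TM_image i setT; rewrite !setIT. Qed.

Lemma TM_trans i j (z : E * E) : (cmap i @` cdom i) z.1 -> cdom j (cinv i z.1) ->
  cmap (j : chart (TM M)) (cinv (i : chart (TM M)) z) =
  (cmap j (cinv i z.1), tchange i j z.1 z.2).
Proof.
move=> ix jx; congr (_, _).
exact: (tchange_comp hM _ ix (chart_atP hM _) jx).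
Qed.

Lemma TM_atlas : is_atlas (TM M).
Proof.
split.
- by move=> v; exact: (chart_atP hM v.1).
- by move=> i v; exact: (@TM_cmapK i v).
- move=> i j; have -> : cmap i @` (cdom i `&` cdom j) =
      [set z : E * E | (cmap (i : chart M) @` (cdom (i : chart M) `&` cdom (j : chart M))) z.1].
    exact: (TM_image i (cdom (j : chart M))).
  have oij := @overlap_open _ _ _ hM i j.
  have sij := @trans_smooth _ _ _ hM i j.
  split; first exact: open_tube.
  apply: (smooth_eq (open_tube oij) _
    (smooth_pair (open_tube oij) (smooth_tube fE oij sij) (smooth_tangent fE oij sij))).
  move=> z /(overlap_im hM)[iz jz] /=; apply: esym; exact: (TM_trans iz jz).
Qed.

Lemma TM_mfd_open_preimage (A : set M) : mfd_open A ->
  mfd_open ([set v | A v.1] : set (TM M)).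
Proof. by move=> oA i; rewrite TM_image; exact/open_tube/oA. Qed.

End TangentManifold.

Section TangentManifoldTopology.
Context {R : realType} {E : normedModType R}.
Context (fE : finite_frame E) (M : mfd E).

(** Vectors at distinct points are separated by the preimages of open sets of [M],
    vectors at one point by open sets of the model space in one chart. *)
Lemma TM_hausdorff (hM : is_manifold M) (v w : TM M) : v <> w ->
  exists U V : set (TM M),
    [/\ mfd_open U, mfd_open V, U v, V w & U `&` V = set0].
Proof.
have aM := manifold_atlas hM; have aT := TM_atlas fE aM.
case: v w => p u [q t] neq.
have [pq|pq] := pselect (p = q); last first.
  have [_ _ _ /(_ p q pq)[U [V [oU oV Up Vq UV]]] _] := hM.
  exists [set v | U v.1], [set v | V v.1]; split => //.
  - exact: TM_mfd_open_preimage.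
  - exact: TM_mfd_open_preimage.
  - apply/seteqP; split => // z [Uz Vz].
    by have : (U `&` V) z.1 by []; rewrite UV.
rewrite -pq in neq *.
have ut : u != t by apply/eqP => ut; apply: neq; rewrite ut.
have := @norm_hausdorff R E; rewrite open_hausdorff => /(_ u t ut).
move=> [[A B] /= [/set_mem Au /set_mem Bt] [oA oB /eqP AB]].
pose c : chart (TM M) := chart_at p.
have oS (S : set E) : open S -> open [set z : E * E | S z.2].
  move=> oS; apply: (@open_comp _ _ (snd : E * E -> E)) => //.
  by move=> x _; exact: snd_continuous.
have cp : cdom (chart_at p) p by exact: chart_atP.
have cv (s : E) : (cmap c (p, s)).2 = s.
  by rewrite /= (tchange_id aM)//; exists p.
exists (cdom c `&` cmap c @^-1` [set z | A z.2]).
exists (cdom c `&` cmap c @^-1` [set z | B z.2]); split.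
- exact: (mfd_open_chart aT c (oS _ oA)).
- exact: (mfd_open_chart aT c (oS _ oB)).
- by split => //; rewrite /preimage /mkset cv.
- by split => //; rewrite /preimage /mkset cv.
- apply/seteqP; split => // z [[_ Az] [_ Bz]].
  by have : (A `&` B) (cmap c z).2 by []; rewrite AB.
Qed.

(** A countable base consists of the boxes B m times C n, read in a chart whose
    domain contains a basic open set B k. The index [k] is what makes the family
    countable: it selects one such chart [ch k], although [M] may have
    uncountably many charts. *)
Lemma TM_second_countable (hM : is_manifold M) : countable_base E ->
  exists B : nat -> set (TM M), (forall n, mfd_open (B n)) /\
    forall U v, mfd_open U -> U v -> exists n, B n v /\ B n `<=` U.
Proof.
move=> [C [oC baseC]].
have aM := manifold_atlas hM; have aT := TM_atlas fE aM.
have [_ _ _ _ [B [oB baseB]]] := hM.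
pose ch k : option (chart M) :=
  if pselect (exists i, B k `<=` cdom i) is left e then Some (sval (cid e)) else None.
pose W (i : chart M) m n : set (E * E) :=
  [set z | (cmap i @` (cdom i `&` B m)) z.1 /\ C n z.2].
pose A (kmn : nat * nat * nat) : set (TM M) :=
  let: (k, m, n) := kmn in
  if ch k is Some i then cdom (i : chart (TM M)) `&` cmap (i : chart (TM M)) @^-1` (W i m n)
  else set0.
have oS (S : set E) : open S -> open [set z : E * E | S z.2].
  move=> oS; apply: (@open_comp _ _ (snd : E * E -> E)) => //.
  by move=> x _; exact: snd_continuous.
have o0 : mfd_open (set0 : set (TM M)).
  by move=> i; rewrite setI0 image_set0; exact: open0.
exists (fun N => if unpickle N is Some kmn then A kmn else set0); split.
  move=> N; case: unpickle => // -[[k m] n]; rewrite /A; case: (ch k) => // i.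
  apply: (mfd_open_chart aT); apply: openI; last exact: (oS _ (oC n)).
  exact/open_tube/oB.
move=> U v oU Uv.
have cv : cdom (chart_at v.1) v.1 by exact: chart_atP.
have [k [Bkv Bkc]] := baseB _ v.1 (mfd_open_cdom aM (chart_at v.1)) cv.
have [i ik Bki] : exists2 i, ch k = Some i & B k `<=` cdom i.
  rewrite /ch; case: pselect => [e|[]]; last by exists (chart_at v.1).
  by exists (sval (cid e)) => //; exact: svalP (cid e).
have iv : cdom i v.1 by exact: Bki.
have oO := oU i; set O := (X in open X) in oO.
have Ov : O (cmap (i : chart (TM M)) v) by exists v.
have [[P Q] /= [Pn Qn] PQ] := open_nbhs_nbhs (conj oO Ov).
have [m [Bmv Bm]] := baseB _ v.1 (mfd_open_chart aM i (open_interior P)) (conj iv Pn).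
have [n [Cnv Cn]] := baseC _ _ (open_interior Q) Qn.
exists (pickle (k, m, n)); rewrite pickleK /A ik; split.
  by split => //; split => //; exists v.1.
move=> w [iw [[q [iq Bq] qw] Cw]].
have qE : q = w.1 by rewrite -[q](cmapK aM iq) qw /= (cmapK aM).
have Ow : O (cmap (i : chart (TM M)) w).
  apply: PQ; split; last by have := interior_subset (Cn _ Cw).
  by rewrite /= -qE; have [_] := Bm _ Bq; exact: interior_subset.
have [w' [iw' Uw'] ww'] := Ow.
by rewrite -[w](TM_cmapK aM iw) -ww' (TM_cmapK aM iw').
Qed.

Lemma TM_manifold (hM : is_manifold M) : countable_base E -> is_manifold (TM M).
Proof.
move=> bE; have [tc tK tt] := TM_atlas fE (manifold_atlas hM).
split => //; first exact: TM_hausdorff.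
exact: TM_second_countable.
Qed.

End TangentManifoldTopology.

(** * Two-forms in charts *)

Lemma cons_arg_map (V W : Type) k (f : V -> W) a (v : 'I_k -> V) :
  (fun l => f (cons_arg a v l)) = cons_arg (f a) (f \o v).
Proof. by apply/funext => l; rewrite /cons_arg; case: unlift. Qed.

Lemma cons_arg2E (V : Type) (v : 'I_2 -> V) :
  v = cons_arg (v ord0) (fun=> v (lift ord0 ord0)).
Proof.
apply/funext => l; rewrite /cons_arg; case: unliftP => [j ->|-> //].
by rewrite (ord1 j).
Qed.

Lemma cons_arg_ord0 (V : Type) k a (v : 'I_k -> V) : cons_arg a v ord0 = a.
Proof. by rewrite /cons_arg unlift_none. Qed.

Lemma cons_arg_lift (V : Type) k a (v : 'I_k -> V) l :
  cons_arg a v (lift ord0 l) = v l.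
Proof. by rewrite /cons_arg liftK. Qed.

Lemma set_arg_cons0 (V : Type) (a b c : V) :
  set_arg (cons_arg a (fun _ : 'I_1 => b)) ord0 c = cons_arg c (fun _ : 'I_1 => b).
Proof.
by rewrite [LHS]cons_arg2E /set_arg /=; congr cons_arg; apply/funext => _; rewrite cons_arg_lift.
Qed.

Lemma set_arg_cons1 (V : Type) (a b c : V) :
  set_arg (cons_arg a (fun _ : 'I_1 => b)) (lift ord0 ord0) c =
  cons_arg a (fun _ : 'I_1 => c).
Proof. by rewrite [LHS]cons_arg2E /set_arg /= cons_arg_ord0. Qed.

Lemma sum_ord2 (A : nmodType) (F : 'I_2 -> A) :
  \sum_(l < 2) F l = F ord0 + F (lift ord0 ord0).
Proof. by rewrite !big_ord_recl big_ord0 addr0. Qed.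

Section TwoForms.
Context {R : realType} {E : normedModType R}.
Context (fE : finite_frame E) (M : mfd E) (hM : is_atlas M).
Context (w : kform M 2) (hw : is_kform w).
Implicit Types (i j : chart M) (p : M) (x a b : E).

Definition twoform_loc i x a b : R := kform_loc w i x (cons_arg a (fun=> b)).

Lemma twoform_loc_at p a b :
  twoform_loc (chart_at p) (cmap (chart_at p) p) a b = w (p := p) (cons_arg a (fun=> b)).
Proof. exact: kform_loc_at. Qed.

Lemma twoform_locE i x a b : twoform_loc i x a b =
  w (p := cinv i x) (cons_arg (tchange i (chart_at (cinv i x)) x a)
    (fun=> tchange i (chart_at (cinv i x)) x b)).
Proof. by rewrite /twoform_loc /kform_loc cons_arg_map. Qed.

Lemma twoform_linear_l p (s : R) (a b c : tangent p) :
  w (cons_arg (s *: a + b) (fun=> c)) =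
  s * w (cons_arg a (fun=> c)) + w (cons_arg b (fun=> c)).
Proof.
have [lw _ _] := hw.
by have := lw p (cons_arg a (fun=> c)) ord0 s a b; rewrite !set_arg_cons0.
Qed.

Lemma twoform_anti p (a b : tangent p) :
  w (cons_arg a (fun=> b)) = - w (cons_arg b (fun=> a)).
Proof.
have [lw aw _] := hw.
have l1 (r : R) (c d e : tangent p) : w (cons_arg e (fun=> r *: c + d)) =
    r * w (cons_arg e (fun=> c)) + w (cons_arg e (fun=> d)).
  by have := lw p (cons_arg e (fun=> c)) (lift ord0 ord0) r c d; rewrite !set_arg_cons1.
have w0 (c : tangent p) : w (cons_arg c (fun=> c)) = 0.
  apply: (aw p _ ord0 (lift ord0 ord0)) => //.
  by rewrite cons_arg_ord0 cons_arg_lift.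
(* Expand the value at (a + b, a + b), which vanishes. *)
have := w0 (1 *: a + b); rewrite (twoform_linear_l 1 a b) !l1 !w0 !mul1r addr0 add0r => /eqP.
by rewrite addr_eq0 => /eqP.
Qed.

Lemma twoform_loc_linear_l i x : (cmap i @` cdom i) x -> forall (s : R) a b c,
  twoform_loc i x (s *: a + b) c = s *: twoform_loc i x a c + twoform_loc i x b c.
Proof.
move=> ix s a b c; rewrite !twoform_locE.
by rewrite (tchange_linear hM _ _ _ ix (chart_atP hM _)) twoform_linear_l.
Qed.

Lemma twoform_loc_anti i x a b : twoform_loc i x a b = - twoform_loc i x b a.
Proof. by rewrite !twoform_locE twoform_anti. Qed.

Lemma twoform_loc_linear_r i x : (cmap i @` cdom i) x -> forall (s : R) a b c,
  twoform_loc i x c (s *: a + b) = s *: twoform_loc i x c a + twoform_loc i x c b.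
Proof.
move=> ix s a b c; rewrite twoform_loc_anti twoform_loc_linear_l//.
by rewrite [in RHS]twoform_loc_anti [X in _ = _ + X]twoform_loc_anti opprD scalerN.
Qed.

Lemma twoform_loc_smooth i a b :
  smooth_on (cmap i @` cdom i) (fun x => twoform_loc i x a b).
Proof. by have [_ _ sw] := hw; exact: sw. Qed.

Lemma twoform_closed p : ext_deriv w = @kform0 R E M 3 ->
  let c := chart_at p in let y := cmap c p in forall a b e,
  'D_a (fun x => twoform_loc c x b e) y - 'D_b (fun x => twoform_loc c x a e) y
  + 'D_e (fun x => twoform_loc c x a b) y = 0.
Proof.
move=> dw c y a b e.
pose v : 'I_3 -> tangent p := cons_arg a (cons_arg b (fun=> e)).
have := congr1 (fun f : kform M 3 => f p v) dw; rewrite /kform0 => <-.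
pose F (l : 'I_3) : R := 'D_(v l) (fun x => kform_loc w c x (v \o lift l)) y.
apply: etrans _ (esym (alternating_sum3 F)).
have FE (l l0 l1 : 'I_3) : lift l (ord0 : 'I_2) = l0 ->
    lift l (lift ord0 ord0 : 'I_2) = l1 ->
    F l = 'D_(v l) (fun x => twoform_loc c x (v l0) (v l1)) y.
  move=> <- <-; rewrite /F; apply: (congr1 (fun f => 'D_(v l) f y)).
  by apply/funext => x; rewrite {1}(cons_arg2E (v \o lift l)).
have v0 : v ord0 = a by rewrite /v cons_arg_ord0.
have v1 : v (lift ord0 ord0) = b by rewrite /v cons_arg_lift cons_arg_ord0.
have v2 : v (lift ord0 (lift ord0 ord0)) = e by rewrite /v !cons_arg_lift.
rewrite (FE ord0 _ _ erefl erefl).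
rewrite (FE (lift ord0 ord0) ord0 (lift ord0 (lift ord0 ord0))); try exact/val_inj.
rewrite (FE (lift ord0 (lift ord0 ord0)) ord0 (lift ord0 ord0)); try exact/val_inj.
by rewrite v0 v1 v2.
Qed.

Lemma twoform_invariant (X : vfield M) p : lie_deriv X w = @kform0 R E M 2 ->
  let c := chart_at p in let y := cmap c p in forall a b,
  'D_(X p) (fun x => twoform_loc c x a b) y
  + (twoform_loc c y ('D_a (vfield_loc X c) y) b
  + twoform_loc c y a ('D_b (vfield_loc X c) y)) = 0.
Proof.
move=> Lw c y a b.
pose v : 'I_2 -> tangent p := cons_arg a (fun=> b).
have := congr1 (fun f : kform M 2 => f p v) Lw; rewrite /kform0 => <-.
rewrite /lie_deriv -/c -/y; apply: (congr1 (fun r => _ + r)).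
pose F (l : 'I_2) : R := w (set_arg v l ('D_(v l) (vfield_loc X c) y)).
apply: esym (etrans (sum_ord2 F) _).
rewrite /F !twoform_loc_at /v set_arg_cons0 set_arg_cons1.
by rewrite cons_arg_ord0 cons_arg_lift.
Qed.

End TwoForms.

(** * The forms i_T w and d_T w *)

Section TautologicalForm.
Context {R : realType} {E : normedModType R}.
Context (fE : finite_frame E) (M : mfd E) (hM : is_atlas M).
Context (w : kform M 2) (hw : is_kform w).
Implicit Types (i j : chart M).

(** The second tangent map of a transition map; its first component shows that
    T tau_M is the projection (a, b) |-> a in every chart. *)
Lemma TM_tchange i j (z h : E * E) : (cmap i @` cdom i) z.1 -> cdom j (cinv i z.1) ->
  tchange (i : chart (TM M)) (j : chart (TM M)) z h =
  (tchange i j z.1 h.1,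
   'D_(h.1) (fun x => 'D_(z.2) (cmap j \o cinv i) x) z.1 + tchange i j z.1 h.2).
Proof.
move=> iz jz.
have oij := @overlap_open _ _ _ hM i j.
have sij := @trans_smooth _ _ _ hM i j.
have oz := overlapP hM iz jz.
have dphi := trans_diff hM iz jz.
rewrite -(derive_tangent h fE oij oz sij) -[X in (X, _)](derive_fst h dphi).
have d1 : differentiable (fun z : E * E => (cmap j \o cinv i) z.1) z.
  exact: (differentiable_comp (differentiable_fst z) dphi).
have d2 : differentiable (fun z : E * E => 'D_(z.2) (cmap j \o cinv i) z.1) z.
  exact: (smooth_diff (smooth_tangent fE oij sij) oz).
apply: etrans _ (derive_pair h d1 d2); rewrite /tchange.
apply: near_eq_derive.
apply: filterS (open_nbhs_nbhs (conj (open_tube (F := E) oij) oz)) => z' /(overlap_im hM)[iz' jz'].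
exact: (TM_trans hM iz' jz').
Qed.

Lemma TM_cmap_at (v : TM M) : cmap (chart_at v : chart (TM M)) v =
  (cmap (chart_at v.1) v.1, v.2).
Proof.
rewrite /=; congr (_, _); apply: (tchange_id hM).
by exists v.1 => //; exact: chart_atP.
Qed.

Lemma tmap_tauM (v : TM M) (h : E * E) :
  (tmap (@tauM R E M) ((v, h) : TM (TM M))).2 = h.1.
Proof.
have cv : cdom (chart_at v.1) v.1 by exact: chart_atP.
transitivity ('D_h (fun z : E * E => cmap (chart_at v.1) (cinv (chart_at v.1) z.1))
  (cmap (chart_at v : chart (TM M)) v)); first by [].
rewrite TM_cmap_at.
rewrite -[RHS](derive_clin (L := fst) (cmap (chart_at v.1) v.1, v.2) h (@fst_continuous _ _ _)).
apply: near_eq_derive.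
have oc := @chart_open _ _ _ hM (chart_at v.1).
have ov : [set z : E * E | (cmap (chart_at v.1) @` cdom (chart_at v.1)) z.1]
  (cmap (chart_at v.1) v.1, v.2) by exists v.1.
apply: filterS (open_nbhs_nbhs (conj (open_tube (F := E) oc) ov)) => z cz /=.
exact: cinvK.
Qed.

Lemma iT_twoform (v : TM M) (u : 'I_1 -> E * E) :
  iT w (p := v) u = w (p := v.1) (cons_arg v.2 (fun=> (u ord0).1)).
Proof.
rewrite /iT; congr (w (cons_arg _ _)); apply/funext => l.
by rewrite tmap_tauM (ord1 l).
Qed.

Lemma iT_loc i z u : (cmap i @` cdom i) z.1 ->
  kform_loc (iT w) (i : chart (TM M)) z u = twoform_loc w i z.1 z.2 (u ord0).1.
Proof.
move=> iz; rewrite /kform_loc iT_twoform twoform_locE.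
by rewrite TM_tchange//; exact: chart_atP.
Qed.

(** In a chart i_T w is (a, b) |-> B_x(u, a) at (x, u): the point (x, u) itself
    enters as an argument of the bilinear form. *)
Lemma iT_is_kform : is_kform (iT w).
Proof.
split.
- move=> v u l s x y; rewrite !iT_twoform (ord1 l) /set_arg /=.
  rewrite (twoform_anti hw) (twoform_linear_l hw) opprD -mulrN.
  by rewrite -!(twoform_anti hw).
- by move=> v u j l; rewrite (ord1 j) (ord1 l) eqxx.
- move=> i u; rewrite TM_chart_image//.
  have oc := @chart_open _ _ _ hM i.
  apply: (smooth_eq (open_tube oc) (f := fun z => twoform_loc w i z.1 z.2 (u ord0).1)).
    by move=> z iz; rewrite iT_loc.
  apply: (smooth_eval (A := fun z a => twoform_loc w i z.1 a (u ord0).1) fE (open_tube oc)).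
  + by move=> z iz s a b; exact: twoform_loc_linear_l.
  + move=> a; exact: (smooth_tube fE oc (twoform_loc_smooth hw i a _)).
  + exact: smooth_snd.
Qed.

Lemma derive_twoform_snd i (z h : E * E) e : (cmap i @` cdom i) z.1 ->
  'D_h (fun z : E * E => twoform_loc w i z.1 z.2 e) z =
  'D_(h.1) (fun x => twoform_loc w i x z.2 e) z.1 + twoform_loc w i z.1 h.2 e.
Proof.
move=> iz.
have oc := @chart_open _ _ _ hM i.
have dw a : differentiable (fun x => twoform_loc w i x a e) z.1.
  exact: (smooth_diff (twoform_loc_smooth hw i a e) iz).
have lA : \near z, forall (s : R) a b,
    twoform_loc w i z.1 (s *: a + b) e =
    s *: twoform_loc w i z.1 a e + twoform_loc w i z.1 b e.
  apply: filterS (open_nbhs_nbhs (conj (open_tube (F := E) oc) iz)) => z' iz' s a b.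
  exact: twoform_loc_linear_l.
have dA a : differentiable (fun z : E * E => twoform_loc w i z.1 a e) z.
  exact: (differentiable_comp (differentiable_fst z) (dw a)).
have dsnd : differentiable (snd : E * E -> E) z.
  by apply: linear_differentiable; exact: snd_continuous.
apply: etrans (derive_eval (A := fun z a => twoform_loc w i z.1 a e) h fE lA dA dsnd) _.
apply: (f_equal2 +%R); first exact: (derive_fst h (dw z.2)).
apply: (congr1 (fun a => twoform_loc w i z.1 a e)).
by apply: derive_clin; exact: snd_continuous.
Qed.

Context (dw0 : ext_deriv w = @kform0 R E M 3).

(** The term i_T (d w) of the complete lift drops out for a closed form. *)
Lemma dT_exact : dT w = ext_deriv (iT w).
Proof.
apply: functional_extensionality_dep => v; apply/funext => u.
by rewrite /dT /kform_add dw0 /iT /kform0 add0r.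
Qed.

(** The curl of i_T w consists of 'D_a B(u, a') - 'D_a' B(u, a), which closedness
    of w identifies with 'D_u B(a, a'), and of the derivatives in u, where B is
    linear. *)
Lemma dT_formula (v : TM M) (h : 'I_2 -> E * E) :
  let c := chart_at v.1 in let y := cmap c v.1 in
  let a := h ord0 in let b := h (lift ord0 ord0) in
  dT w (p := v) h = 'D_(v.2) (fun x => twoform_loc w c x a.1 b.1) y +
    twoform_loc w c y a.2 b.1 + twoform_loc w c y a.1 b.2.
Proof.
move=> c y a b; rewrite dT_exact (ext_deriv_oneform (iT w) h).
rewrite TM_cmap_at /oneform_curl -/a -/b.
have cy : (cmap c @` cdom c) y by exists v.1 => //; exact: chart_atP.
have oc := @chart_open _ _ _ hM c.
have main (k e : E * E) :
    'D_k (fun z => oneform_loc (iT w) (chart_at v) z e) (y, v.2) =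
    'D_(k.1) (fun x => twoform_loc w c x v.2 e.1) y + twoform_loc w c y k.2 e.1.
  apply: etrans _ (@derive_twoform_snd c (y, v.2) k e.1 cy).
  apply: near_eq_derive.
  have oy : [set z : E * E | (cmap c @` cdom c) z.1] (y, v.2) by [].
  apply: filterS (open_nbhs_nbhs (conj (open_tube (F := E) oc) oy)) => z iz.
  exact: iT_loc.
have cl := twoform_closed v.1 dw0 v.2 a.1 b.1.
have alg (d0 da db t1 t2 t3 : R) : d0 - da + db = 0 -> t2 = - t3 ->
    da + t1 - (db + t2) = d0 + t1 + t3.
  by move=> /eqP; rewrite addr_eq0 subr_eq => /eqP -> ->; ring.
apply: etrans (f_equal2 (fun r s => r - s) (main a b) (main b a)) _.
exact: (alg _ _ _ _ _ _ cl (twoform_loc_anti hw _ _ _ _)).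
Qed.

End TautologicalForm.

(** * Complete lifts *)

Section CompleteLift.
Context {R : realType} {E : normedModType R}.
Context (fE : finite_frame E) (M : mfd E) (hM : is_atlas M).
Implicit Types (i j : chart M) (X Y : vfield M).

Lemma complete_lift_at X (v : TM M) : smooth_vfield X ->
  complete_lift X v =
  (X v.1, 'D_(v.2) (vfield_loc X (chart_at v.1)) (cmap (chart_at v.1) v.1)).
Proof.
move=> sX; pose c := chart_at v.1; pose y := cmap c v.1.
have cy : (cmap c @` cdom c) y by exists v.1 => //; exact: chart_atP.
have dX : differentiable (vfield_loc X c) y by exact: smooth_diff (sX c) cy.
apply: (congr1 (fun h : E * E => (X v.1, h.2))
  (x := 'D_(v.2) (fun x => (cmap c (cinv c x), vfield_loc X c x)) y)
  (y := (v.2, 'D_(v.2) (vfield_loc X c) y))).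
transitivity ('D_(v.2) (fun x => (x, vfield_loc X c x)) y).
  apply: near_eq_derive.
  apply: filterS (open_nbhs_nbhs (conj (@chart_open _ _ _ hM c) cy)) => x cx.
  by rewrite (cinvK hM).
have did : differentiable (fun x : E => x) y by exact: ex_diff.
rewrite (derive_pair _ did dX); congr (_, _); exact: derive_id.
Qed.

(** At the base point of [z] the second component is the derivative of [X] in the
    preferred chart, moved to the chart [i] by the second tangent map of the
    transition map; up to the symmetry of second derivatives this is the
    expression found in [derive_vfield_loc]. *)
Lemma complete_lift_loc X i (z : E * E) : smooth_vfield X ->
  (cmap i @` cdom i) z.1 ->
  vfield_loc (complete_lift X) (i : chart (TM M)) z =
  (vfield_loc X i z.1, 'D_(z.2) (vfield_loc X i) z.1).
Proof.
move=> sX iz.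
pose p := cinv i z.1; pose c := chart_at p; pose y := cmap c p.
have ip : cdom i p by exact: cdom_cinv.
have cp : cdom c p by exact: chart_atP.
have cy : (cmap c @` cdom c) y by exists p.
have yp : cinv c y = p by exact: cmapK.
have iy : cdom i (cinv c y) by rewrite yp.
have yx : cmap i (cinv c y) = z.1 by rewrite yp (cinvK hM).
pose u := tchange i c z.1 z.2.
have uE : tchange c i y u = z.2.
  by rewrite /u /y (tchange_comp hM _ iz cp ip) (tchange_id hM).
pose v : TM M := (p, u).
have -> : vfield_loc (complete_lift X) (i : chart (TM M)) z =
    tchange (c : chart (TM M)) (i : chart (TM M)) (y, u) (complete_lift X v).
  by rewrite -(TM_cmap_at hM v).
rewrite (TM_tchange fE hM _ (z := (y, u)) cy iy) (complete_lift_at _ sX) /=.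
have Xy : X p = vfield_loc X c y by rewrite vfield_loc_at.
have XE : tchange c i y (X p) = vfield_loc X i z.1.
  by rewrite Xy -(vfield_loc_change hM X cy iy) yx.
apply: (congr2 pair) => //.
have := derive_vfield_loc fE hM u sX cy iy; rewrite uE yx => ->.
apply: (f_equal2 +%R); last by [].
rewrite Xy; apply: (derive_sym _ _ fE (@overlap_open _ _ _ hM c i)).
  exact: overlapP.
exact: trans_smooth.
Qed.

Lemma complete_lift_smooth X : smooth_vfield X -> smooth_vfield (complete_lift X).
Proof.
move=> sX i; rewrite TM_chart_image//.
have oc := @chart_open _ _ _ hM i.
apply: (smooth_eq (open_tube oc) _ (smooth_pair (open_tube oc)
  (smooth_tube fE oc (sX i)) (smooth_tangent fE oc (sX i)))).
by move=> z iz; rewrite complete_lift_loc.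
Qed.

Lemma vfield_loc_linear X Y Z (a : R) i x : (cmap i @` cdom i) x ->
  (forall p, Z p = a *: X p + Y p) ->
  vfield_loc Z i x = a *: vfield_loc X i x + vfield_loc Y i x.
Proof.
move=> ix ZE; rewrite /vfield_loc ZE; apply: (tchange_linear hM).
  by exists (cinv i x) => //; exact: chart_atP.
by rewrite (cmapK hM (chart_atP hM _)); exact: cdom_cinv.
Qed.

Lemma complete_lift_linear X Y Z (a : R) : smooth_vfield X -> smooth_vfield Y ->
  smooth_vfield Z -> (forall p, Z p = a *: X p + Y p) ->
  forall v, complete_lift Z v = a *: complete_lift X v + complete_lift Y v.
Proof.
move=> sX sY sZ ZE v; rewrite !complete_lift_at//.
pose c := chart_at v.1; pose y := cmap c v.1.
have cy : (cmap c @` cdom c) y by exists v.1 => //; exact: chart_atP.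
have dX : differentiable (vfield_loc X c) y by exact: smooth_diff (sX c) cy.
have dY : differentiable (vfield_loc Y c) y by exact: smooth_diff (sY c) cy.
have dvX := @diff_derivable _ _ _ _ y v.2 dX.
have dvY := @diff_derivable _ _ _ _ y v.2 dY.
suff D : 'D_(v.2) (vfield_loc Z c) y =
    a *: 'D_(v.2) (vfield_loc X c) y + 'D_(v.2) (vfield_loc Y c) y.
  exact: (congr2 pair (ZE _) D).
rewrite -(deriveZ a dvX) -(deriveD (derivableZ (k := a) dvX) dvY).
apply: near_eq_derive.
apply: filterS (open_nbhs_nbhs (conj (@chart_open _ _ _ hM c) cy)) => x cx.
exact: vfield_loc_linear.
Qed.

(** Both sides have second component
    'D_X 'D_u Y + 'D_('D_u X) Y - 'D_Y 'D_u X - 'D_('D_u Y) X: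
    on the right by differentiating (x, u) |-> (Y x, 'D_u Y x), on the left by
    differentiating the coordinate expression of [X, Y] along u. *)
Lemma complete_lift_bracket X Y : smooth_vfield X -> smooth_vfield Y ->
  smooth_vfield (vbracket X Y) ->
  complete_lift (vbracket X Y) = vbracket (complete_lift X) (complete_lift Y).
Proof.
move=> sX sY sXY; apply: functional_extensionality_dep => v.
rewrite complete_lift_at//.
pose c := chart_at v.1; pose y := cmap c v.1; pose u := v.2.
have cy : (cmap c @` cdom c) y by exists v.1 => //; exact: chart_atP.
have oc := @chart_open _ _ _ hM c.
have oy : [set z : E * E | (cmap c @` cdom c) z.1] (y, u) by [].
have dv (Z : vfield M) : smooth_vfield Z -> differentiable (vfield_loc Z c) y.
  by move=> sZ; exact: smooth_diff (sZ c) cy.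
have dDv (Z : vfield M) a : smooth_vfield Z ->
    differentiable (fun x => 'D_a (vfield_loc Z c) x) y.
  by move=> sZ; exact: smooth_diff (smooth_derive a (sZ c)) cy.
have Xy (Z : vfield M) : Z v.1 = vfield_loc Z c y by rewrite vfield_loc_at.
(* The two halves of the bracket of the lifts, in the chart [c]. *)
have side (X' Y' : vfield M) : smooth_vfield X' -> smooth_vfield Y' ->
    'D_(complete_lift X' v) (vfield_loc (complete_lift Y') (c : chart (TM M))) (y, u) =
    ('D_(vfield_loc X' c y) (vfield_loc Y' c) y,
     'D_(vfield_loc X' c y) (fun x => 'D_u (vfield_loc Y' c) x) y +
     'D_('D_u (vfield_loc X' c) y) (vfield_loc Y' c) y).
  move=> sX' sY'; rewrite complete_lift_at// Xy.
  pose h : E * E := (vfield_loc X' c y, 'D_u (vfield_loc X' c) y).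
  have d1 : differentiable (fun z : E * E => vfield_loc Y' c z.1) (y, u).
    exact: (differentiable_comp (differentiable_fst (y, u)) (dv _ sY')).
  have d2 : differentiable (fun z : E * E => 'D_(z.2) (vfield_loc Y' c) z.1) (y, u).
    exact: (smooth_diff (smooth_tangent fE oc (sY' c)) oy).
  transitivity ('D_h (fun z : E * E => (vfield_loc Y' c z.1,
     'D_(z.2) (vfield_loc Y' c) z.1)) (y, u)).
    apply: near_eq_derive.
    apply: filterS (open_nbhs_nbhs (conj (open_tube (F := E) oc) oy)) => z cz.
    exact: complete_lift_loc.
  apply: etrans (derive_pair h d1 d2) _; apply: (congr2 pair).
    exact: (derive_fst h (v := (y, u)) (dv _ sY')).
  exact: (derive_tangent h (v := (y, u)) fE oc cy (sY' c)).
(* The field 'D_X' Y' depends on the point through Y' and through the direction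
   X'; each contributes one term to its derivative along [u]. *)
have deriv (X' Y' : vfield M) : smooth_vfield X' -> smooth_vfield Y' ->
    differentiable (fun x => 'D_(vfield_loc X' c x) (vfield_loc Y' c) x) y /\
    'D_u (fun x => 'D_(vfield_loc X' c x) (vfield_loc Y' c) x) y =
    'D_(vfield_loc X' c y) (fun x => 'D_u (vfield_loc Y' c) x) y +
    'D_('D_u (vfield_loc X' c) y) (vfield_loc Y' c) y.
  move=> sX' sY'.
  have lA : \near y, forall (s : R) a b,
      'D_(s *: a + b) (vfield_loc Y' c) y =
      s *: 'D_a (vfield_loc Y' c) y + 'D_b (vfield_loc Y' c) y.
    apply: filterS (open_nbhs_nbhs (conj oc cy)) => x cx s a b.
    by apply: derive_linear; exact: smooth_diff (sY' c) cx.
  split.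
    exact: (differentiable_eval (A := fun x a => 'D_a (vfield_loc Y' c) x) fE
      lA (fun a => dDv _ a sY') (dv _ sX')).
  apply: etrans (derive_eval (A := fun x a => 'D_a (vfield_loc Y' c) x) u fE
      lA (fun a => dDv _ a sY') (dv _ sX')) _.
  apply: (f_equal2 +%R); last by [].
  exact: (derive_sym _ _ fE oc cy (sY' c)).
have [dXY DXY] := deriv X Y sX sY; have [dYX DYX] := deriv Y X sY sX.
have -> : vbracket (complete_lift X) (complete_lift Y) v =
    'D_(complete_lift X v) (vfield_loc (complete_lift Y) (c : chart (TM M))) (y, u) -
    'D_(complete_lift Y v) (vfield_loc (complete_lift X) (c : chart (TM M))) (y, u).
  by rewrite /vbracket -(TM_cmap_at hM v).
apply: etrans _ (esym (f_equal2 (fun a b : E * E => a - b)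
  (side X Y sX sY) (side Y X sY sX))).
apply: (congr2 pair).
  by rewrite /vbracket -/c -/y !Xy.
apply: etrans _ (f_equal2 (fun a b => a - b) DXY DYX).
apply: etrans _ (deriveB (@diff_derivable _ _ _ _ y u dXY)
  (@diff_derivable _ _ _ _ y u dYX)).
apply: near_eq_derive; apply: filterS (open_nbhs_nbhs (conj oc cy)) => x cx.
exact: vbracket_loc.
Qed.

End CompleteLift.

(** * The momentum map *)

Lemma ext_deriv_fun (R : realType) (E : normedModType R) (N : mfd E) (f : N -> R)
    (p : N) (v : 'I_1 -> tangent p) :
  ext_deriv (kform_of_fun f) v =
  'D_(v ord0) (f \o cinv (chart_at p)) (cmap (chart_at p) p).
Proof. by rewrite /ext_deriv big_ord1 expr0 mul1r. Qed.

(** Nondegeneracy leaves at most one solution of i_X w = df, so the one chosen by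
    [ham_vfield] is [X]. *)
Lemma ham_vfield_unique (R : realType) (E : normedModType R) (N : mfd E)
    (w : kform N 2) (f : N -> R) (X : vfield N) : is_kform w -> nondeg_form w ->
  interior_prod X w = ext_deriv (kform_of_fun f) -> ham_vfield w f = X.
Proof.
move=> kw nw Xf; apply: xget_unique => // Y; rewrite /mkset => Yf.
apply: functional_extensionality_dep => p; apply/eqP; rewrite -subr_eq0; apply/eqP.
apply: nw => y.
have -> : y = fun=> y ord0 by apply/funext => l; rewrite (ord1 l).
have -> : Y p - X p = (-1) *: X p + Y p by rewrite scaleN1r addrC.
rewrite (twoform_linear_l kw).
have := congr1 (fun h : kform N 1 => h p (fun=> y ord0)) (etrans Yf (esym Xf)).
by rewrite /interior_prod => ->; rewrite mulN1r addNr.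
Qed.

Section Momentum.
Context {R : realType} {E : normedModType R}.
Context (fE : finite_frame E) (M : mfd E) (hM : is_atlas M).
Context (w : kform M 2) (hw : is_kform w).
Implicit Types (i j : chart M) (X Y : vfield M).

Definition momentum X (v : TM M) : R := w (p := v.1) (cons_arg (X v.1) (fun=> v.2)).

Lemma momentumE X v : momentum X v = fun_of_kform (iT (interior_prod X w)) v.
Proof.
rewrite /momentum /fun_of_kform /iT /interior_prod; congr (w (cons_arg _ _)).
by apply/funext => l; rewrite /cons_arg (ord1 l) unlift_none.
Qed.

Lemma momentum_loc X i (z : E * E) : (cmap i @` cdom i) z.1 ->
  momentum X (cinv (i : chart (TM M)) z) =
  twoform_loc w i z.1 (vfield_loc X i z.1) z.2.
Proof.
move=> iz; rewrite twoform_locE /momentum /=; congr (w (cons_arg _ _)).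
have cp := chart_atP hM (cinv i z.1); have ip := cdom_cinv hM iz.
rewrite -[in RHS](cinvK hM iz) /vfield_loc !(cmapK hM ip).
by rewrite (tchangeK hM).
Qed.

Lemma momentum_smooth X : smooth_vfield X -> smooth_fun (momentum X).
Proof.
move=> sX i; rewrite TM_chart_image//.
have oc := @chart_open _ _ _ hM i.
apply: (smooth_eq (open_tube oc)
  (f := fun z => twoform_loc w i z.1 (vfield_loc X i z.1) z.2)).
  by move=> z iz; rewrite /= momentum_loc.
apply: (smooth_eval (A := fun z a => twoform_loc w i z.1 (vfield_loc X i z.1) a)
  fE (open_tube oc)).
- by move=> z iz s a b; exact: twoform_loc_linear_r.
- move=> a.
  apply: (smooth_tube (f := fun x => twoform_loc w i x (vfield_loc X i x) a) fE oc).
  apply: (smooth_eval (A := fun x b => twoform_loc w i x b a) fE oc) => //.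
  + by move=> x ix s b c; exact: twoform_loc_linear_l.
  + by move=> b; exact: twoform_loc_smooth.
- exact: smooth_snd.
Qed.

Lemma derive_momentum X (v : TM M) (h : E * E) : smooth_vfield X ->
  let c := chart_at v.1 in let y := cmap c v.1 in
  'D_h (momentum X \o cinv (chart_at v : chart (TM M)))
    (cmap (chart_at v : chart (TM M)) v) =
  'D_(h.1) (fun x => twoform_loc w c x (X v.1) v.2) y +
  twoform_loc w c y ('D_(h.1) (vfield_loc X c) y) v.2 +
  twoform_loc w c y (X v.1) h.2.
Proof.
move=> sX c y; rewrite (TM_cmap_at hM v).
have cy : (cmap c @` cdom c) y by exists v.1 => //; exact: chart_atP.
have oc := @chart_open _ _ _ hM c.
have oy : [set z : E * E | (cmap c @` cdom c) z.1] (y, v.2) by [].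
have Xy : X v.1 = vfield_loc X c y by rewrite vfield_loc_at.
have dX : differentiable (vfield_loc X c) y by exact: smooth_diff (sX c) cy.
have dw a b : differentiable (fun x => twoform_loc w c x a b) y.
  exact: (smooth_diff (twoform_loc_smooth hw c a b) cy).
have lA a : \near y, forall (s : R) b d,
    twoform_loc w c y (s *: b + d) a =
    s *: twoform_loc w c y b a + twoform_loc w c y d a.
  apply: filterS (open_nbhs_nbhs (conj oc cy)) => x cx s b d.
  exact: twoform_loc_linear_l.
have dwX a : differentiable (fun x => twoform_loc w c x (vfield_loc X c x) a) y.
  exact: (differentiable_eval (A := fun x b => twoform_loc w c x b a) fE
    (lA a) (fun b => dw b a) dX).
have lB : \forall z \near ((y, v.2) : E * E), forall (s : R) b d,
    twoform_loc w c z.1 (vfield_loc X c z.1) (s *: b + d) =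
    s *: twoform_loc w c z.1 (vfield_loc X c z.1) b +
    twoform_loc w c z.1 (vfield_loc X c z.1) d.
  apply: filterS (open_nbhs_nbhs (conj (open_tube (F := E) oc) oy)) => z cz s b d.
  exact: twoform_loc_linear_r.
have dB a : differentiable (fun z : E * E =>
    twoform_loc w c z.1 (vfield_loc X c z.1) a) (y, v.2).
  exact: (differentiable_comp (differentiable_fst (y, v.2)) (dwX a)).
have dsnd : differentiable (snd : E * E -> E) (y, v.2).
  by apply: linear_differentiable; exact: snd_continuous.
transitivity ('D_h (fun z : E * E =>
    twoform_loc w c z.1 (vfield_loc X c z.1) z.2) (y, v.2)).
  apply: near_eq_derive.
  apply: filterS (open_nbhs_nbhs (conj (open_tube (F := E) oc) oy)) => z cz.
  exact: momentum_loc.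
apply: etrans (derive_eval
  (A := fun z a => twoform_loc w c z.1 (vfield_loc X c z.1) a) h fE lB dB dsnd) _.
apply: (f_equal2 +%R); last first.
  rewrite Xy; apply: (congr1 (twoform_loc w c y (vfield_loc X c y))).
  by apply: derive_clin; exact: snd_continuous.
apply: etrans (derive_fst h (v := (y, v.2)) (dwX v.2)) _.
rewrite Xy.
exact: (derive_eval (A := fun x b => twoform_loc w c x b v.2) h.1 fE
    (lA v.2) (fun b => dw b v.2) dX).
Qed.

Context (dw0 : ext_deriv w = @kform0 R E M 3) (nw : nondeg_form w).

Lemma dT_is_kform : is_kform (dT w).
Proof.
rewrite (dT_exact dw0).
apply: (ext_deriv_is_kform (finite_frame_prod fE fE) (TM_atlas fE hM)).
exact: iT_is_kform.
Qed.

Lemma dT_ext_deriv : ext_deriv (dT w) = @kform0 R _ (TM M) 3.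
Proof.
rewrite (dT_exact dw0).
apply: (ext_derivK_oneform (finite_frame_prod fE fE) (TM_atlas fE hM)).
exact: iT_is_kform.
Qed.

(** Pairing with vertical vectors (0, b') sees only the component a, and once
    a = 0 pairing with (a', 0) sees only b. *)
Lemma dT_nondeg : nondeg_form (dT w).
Proof.
move=> v a da.
pose c := chart_at v.1; pose y := cmap c v.1.
have cy : (cmap c @` cdom c) y by exists v.1 => //; exact: chart_atP.
have dE (b : E * E) : 'D_(v.2) (fun x => twoform_loc w c x a.1 b.1) y +
    twoform_loc w c y a.2 b.1 + twoform_loc w c y a.1 b.2 = 0.
  have := da (fun=> b); rewrite (dT_formula fE hM hw dw0) cons_arg_ord0 cons_arg_lift.
  exact.
have l0 i x b : (cmap i @` cdom i) x -> twoform_loc w i x 0 b = 0.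
  move=> ix; have := twoform_loc_linear_l hM hw ix (-1) 0 0 b.
  by rewrite scaleN1r oppr0 addr0 scaleN1r addNr.
have r0 i x b : (cmap i @` cdom i) x -> twoform_loc w i x b 0 = 0.
  by move=> ix; rewrite (twoform_loc_anti hw) l0 ?oppr0.
have oc := @chart_open _ _ _ hM c.
have a1 : a.1 = 0.
  apply: (nw (p := v.1)) => b.
  have -> : b = fun=> b ord0 by apply/funext => l; rewrite (ord1 l).
  have := dE (0, b ord0).
  have -> : 'D_(v.2) (fun x => twoform_loc w c x a.1 (0, b ord0).1) y = 0.
    transitivity ('D_(v.2) (cst (0 : R)) y); last exact: derive_cst.
    apply: near_eq_derive; apply: filterS (open_nbhs_nbhs (conj oc cy)) => x cx.
    exact: r0.
  by rewrite /= r0// !add0r twoform_loc_at.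
have a2 : a.2 = 0.
  apply: (nw (p := v.1)) => b.
  have -> : b = fun=> b ord0 by apply/funext => l; rewrite (ord1 l).
  have := dE (b ord0, 0); rewrite a1.
  have -> : 'D_(v.2) (fun x => twoform_loc w c x 0 (b ord0, 0).1) y = 0.
    transitivity ('D_(v.2) (cst (0 : R)) y); last exact: derive_cst.
    apply: near_eq_derive; apply: filterS (open_nbhs_nbhs (conj oc cy)) => x cx.
    exact: l0.
  by rewrite /= r0// add0r addr0 twoform_loc_at.
by rewrite [a]surjective_pairing a1 a2.
Qed.

(** In coordinates both sides contain B(X, b'); the remaining terms agree by the
    closedness of w on (X, u, a') and its invariance under X on (u, a'). *)
Lemma complete_lift_hamiltonian X : smooth_vfield X ->
  lie_deriv X w = @kform0 R E M 2 ->
  interior_prod (complete_lift X) (dT w) = ext_deriv (kform_of_fun (momentum X)).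
Proof.
move=> sX Lw; apply: functional_extensionality_dep => v; apply/funext => h.
rewrite ext_deriv_fun /interior_prod (dT_formula fE hM hw dw0).
rewrite cons_arg_ord0 cons_arg_lift (complete_lift_at hM v sX).
pose c := chart_at v.1; pose y := cmap c v.1; set e := h ord0.
apply: etrans _ (esym (derive_momentum v e sX)).
have cl := twoform_closed v.1 dw0 (X v.1) v.2 e.1.
have iv := twoform_invariant hM v.1 Lw v.2 e.1.
have alg (dx du de t1 t2 t3 s : R) : dx - du + de = 0 -> dx + (t1 + s) = 0 ->
    t2 = - s -> du + t1 + t3 = de + t2 + t3.
  move=> /eqP; rewrite addrAC subr_eq0 => /eqP <- /eqP.
  by rewrite addrCA addr_eq0 => /eqP -> ->; ring.
exact: (alg _ _ _ _ _ _ _ cl iv (twoform_loc_anti hw _ _ _ _)).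
Qed.

(** {c_X, c_Y} is the derivative of c_Y along X^T, that is
    'D_X B(Y, u) + B('D_X Y, u) + B(Y, 'D_u X); invariance of w under X on (Y, u)
    replaces the outer terms by - B('D_Y X, u). *)
Lemma poisson_momentum X Y : smooth_vfield X -> smooth_vfield Y ->
  lie_deriv X w = @kform0 R E M 2 ->
  poisson_bracket (dT w) (momentum X) (momentum Y) = momentum (vbracket X Y).
Proof.
move=> sX sY Lw; rewrite /poisson_bracket.
rewrite (ham_vfield_unique dT_is_kform dT_nondeg (complete_lift_hamiltonian sX Lw)).
apply/funext => v; rewrite /vapply /fun_of_kform /interior_prod ext_deriv_fun.
rewrite cons_arg_ord0 (complete_lift_at hM v sX).
pose c := chart_at v.1; pose y := cmap c v.1.
have cy : (cmap c @` cdom c) y by exists v.1 => //; exact: chart_atP.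
apply: etrans (derive_momentum v _ sY) _.
have iv := twoform_invariant hM v.1 Lw (Y v.1) v.2.
transitivity (twoform_loc w c y (vbracket X Y v.1) v.2); last exact: twoform_loc_at.
have lin := twoform_loc_linear_l hM hw cy (-1) ('D_(Y v.1) (vfield_loc X c) y)
  ('D_(X v.1) (vfield_loc Y c) y) v.2.
have -> : vbracket X Y v.1 = -1 *: 'D_(Y v.1) (vfield_loc X c) y +
    'D_(X v.1) (vfield_loc Y c) y by rewrite scaleN1r addrC.
have alg (d t1 t2 t3 : R) : d + (t1 + t3) = 0 -> d + t2 + t3 = -1 * t1 + t2.
  by move=> /eqP; rewrite addrCA addr_eq0 => /eqP ->; ring.
apply: etrans _ (esym lin); exact: (alg _ _ _ _ iv).
Qed.

End Momentum.

Section MomentumMap.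
Context {R : realType} {E : normedModType R} (M : mfd E).
Context (g : lmodType R) (w : kform M 2) (hw : is_kform w) (phi : g -> vfield M)
  (phi_linear : forall a x y p, phi (a *: x + y) p = a *: phi x p + phi y p).

Lemma momentum_is_linear (v : TM M) :
  linear_for *%R (fun xi => momentum w (phi xi) v).
Proof. by move=> a x y; rewrite /momentum phi_linear (twoform_linear_l hw). Qed.

Definition momentum_map (v : TM M) : {scalar g} :=
  HB.pack (fun xi => momentum w (phi xi) v)
    (GRing.isLinear.Build _ _ _ _ _ (momentum_is_linear v)).

End MomentumMap.

(** * The lifted action is Hamiltonian *)

Theorem corollary4p6 (R : realType) (n : nat) (M : mfd 'rV[R]_n)
    (omega : kform M 2) (g : lmodType R) (br : g -> g -> g)
    (phi : g -> vfield M)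
    (hM : symplectic_manifold omega) (hg : lie_algebra br)
    (hphi : symplectic_action br omega phi) :
  exists c : TM M -> {scalar g},
    [/\ forall (v : TM M) (xi : g),
          c v xi = fun_of_kform (iT (interior_prod (phi xi) omega)) v,
        hamiltonian_action br (dT omega) (fun xi => complete_lift (phi xi)) c &
        fiberwise_linear c].
Proof.
have [mM kw dw nw] := hM.
have [[sphi lphi bphi] Lphi] := hphi.
have fE := @finite_frame_rV R n.
have aM := manifold_atlas mM.
exists (momentum_map kw lphi); split.
- by move=> v xi; exact: momentumE.
- have ham xi := ham_vfield_unique (dT_is_kform fE aM kw dw) (dT_nondeg fE aM kw dw nw)
    (complete_lift_hamiltonian fE aM kw dw (sphi xi) (Lphi xi)).
  split.
  + split.
    * exact: (TM_manifold fE mM (@countable_base_rV R n)).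
    * exact: (dT_is_kform fE aM kw dw).
    * exact: (dT_ext_deriv fE aM kw dw).
    * exact: (dT_nondeg fE aM kw dw nw).
  + split.
    * by move=> xi; exact: (complete_lift_smooth fE aM (sphi xi)).
    * by move=> a x y v; apply: (complete_lift_linear aM) => // p; exact: lphi.
    * move=> x y; rewrite bphi; apply: (complete_lift_bracket fE aM) => //.
      by rewrite -bphi.
  + by move=> xi; exact: (momentum_smooth fE aM kw (sphi xi)).
  + by move=> xi; rewrite -[LHS]ham.
  + move=> x y; apply: etrans (poisson_momentum fE aM kw dw nw (sphi x) (sphi y) (Lphi x)) _.
    by rewrite -bphi.
- move=> p a u v xi.
  rewrite [LHS](twoform_anti kw) (twoform_linear_l kw) opprD -mulrN.
  by rewrite -!(twoform_anti kw).
Qed.
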